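(* Let $w$ be an admissible weight on $[0,1)$ with associated radii $(r_n)_{n\ge 0}$, annuli $\Omega_n$ and weighted Bergman space $A^2_w$ (all as defined in the context). A nonnegative Borel measure $\mu$ on $\mathbb{D}$ is a Carleson measure for $A^2_w$ if and only if there is a constant $C'>0$, independent of $n$, such that for every integer $n\ge 0$ the measure $\mu_n$ given by $d\mu_n(z)=\chi_{\Omega_n}(z)\,d\mu(z)$ is a Carleson measure for the Hardy space $H^2$ with Carleson constant at most $C'\,2^{-n}$.
   Context: $\mathbb{D}$ is the open unit disk in $\mathbb{C}$ and $\sigma$ is Lebesgue area measure on $\mathbb{D}$. Admissible weight: $w$ is a positive continuous function on $[0,1)$ with $\int_0^1 w(x)\,dx=1$, for which there is a constant $c>0$ such that $w(1-t)\ge c\,w(1-2t)$ whenever $0<t\le 1/2$. The radii $0\le r_n<1$ are defined by $\int_{r_n}^1 w(x)\,dx=2^{-n}$ for every integer $n\ge 0$ (so $r_0=0$), and $\Omega_n=\{z:\ r_n\le |z|<r_{n+1}\}$. $A^2_w$ is the space of all functions $f$ analytic in $\mathbb{D}$ with $\int_{\mathbb{D}}|f(z)|^2 w(|z|)\,d\sigma(z)<\infty$, equipped with the (equivalent) norm $$\|f\|_w^2=\sum_{n=1}^\infty 2^{-n}\int_0^{2\pi}|f(r_ne^{it})|^2\,\frac{dt}{2\pi}.$$ $H^2$ is the space of all functions $f$ analytic in $\mathbb{D}$ with $\|f\|_{H^2}^2=\sup_{r<1}\int_0^{2\pi}|f(re^{it})|^2\frac{dt}{2\pi}<\infty$. For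 a Hilbert space $\mathcal{H}$ of analytic functions on $\mathbb{D}$, a nonnegative Borel measure $\mu$ on $\mathbb{D}$ is a Carleson measure for $\mathcal{H}$ if there is a constant $C>0$ with $\int_{\mathbb{D}}|f(z)|^2\,d\mu(z)\le C\|f\|_{\mathcal{H}}^2$ for all $f\in\mathcal{H}$; the smallest such $C$ is the Carleson constant of $\mu$. *)

(* Defs.v *)
From HB Require Import structures.
From mathcomp Require Import all_boot all_order all_algebra.
From mathcomp Require Import all_classical all_reals all_analysis.
From mathcomp Require Import measurable_realfun complex.

Set Implicit Arguments.
Unset Strict Implicit.
Unset Printing Implicit Defensive.

Import Order.TTheory GRing.Theory Num.Theory.
Import numFieldNormedType.Exports.

Local Open Scope classical_set_scope.
Local Open Scope ring_scope.

(* The plane as a measurable space: the product sigma-algebra on R * R is the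
   Borel sigma-algebra of the plane, identified with R[i] through [cplx]. *)
Notation plane R := (measurableTypeR R * measurableTypeR R)%type.

Definition cplx (R : realType) (p : plane R) : R[i] := (p.1 +i* p.2)%C.

Definition modulus (R : realType) (z : R[i]) : R := ComplexField.Normc.normc z.

Definition unit_disk (R : realType) : set R[i] := [set z | modulus z < 1].

(* Analyticity is complex differentiability: [derivable _ z 1] is taken over the
   normed field R[i], so it is the limit of (f (z + h) - f z) / h for complex
   h -> 0.  Values of f outside the disk play no role. *)
Definition analytic_disk (R : realType) (f : R[i] -> R[i]) : Prop :=
  forall z : R[i], unit_disk z ->
    @derivable R[i] (R[i])^o (R[i])^o f z (1 : R[i]).

Definition area (R : realType) : set (plane R) -> \bar R :=
  (@lebesgue_measure R \x @lebesgue_measure R)%E.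

(* Integral over the unit disk of g : R[i] -> \bar R.  A measure on the disk is
   represented by a measure on the plane, of which only the part carried by the
   disk is used. *)
Definition disk_integral (R : realType) (mu : set (plane R) -> \bar R)
    (g : R[i] -> \bar R) : \bar R :=
  (\int[mu]_(p in @cplx R @^-1` @unit_disk R) g (cplx p))%E.

Definition circle_mean (R : realType) (f : R[i] -> R[i]) (rho : R) : \bar R :=
  (\int[@lebesgue_measure R]_(t in `[0%R, (2 * pi)%R])
     (modulus (f ((rho * cos t) +i* (rho * sin t))%C) ^+ 2 / (2 * pi))%:E)%E.

Definition admissible_weight (R : realType) (w : R -> R) : Prop :=
  [/\ {within `[0, 1[, continuous w},
      forall x : R, 0 <= x < 1 -> 0 < w x,
      (\int[@lebesgue_measure R]_(x in `[0%R, 1%R[) (w x)%:E = 1)%E &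
      exists2 c : R, 0 < c &
        forall t : R, 0 < t <= 1 / 2 -> c * w (1 - 2 * t) <= w (1 - t)].

(* The sequence r is uniquely determined by w since w is positive. *)
Definition weight_radii (R : realType) (w : R -> R) (r : nat -> R) : Prop :=
  forall n, 0 <= r n < 1 /\
    (\int[@lebesgue_measure R]_(x in `[r n, 1%R[) (w x)%:E
       = ((2 ^- n)%R : R)%:E)%E.

Definition bergman (R : realType) (w : R -> R) : set (R[i] -> R[i]) :=
  [set f | analytic_disk f /\
    (disk_integral (@area R)
       (fun z => (modulus (f z) ^+ 2 * w (modulus z))%:E) < +oo)%E].

Definition bergman_sqnorm (R : realType) (r : nat -> R) (f : R[i] -> R[i]) :
    \bar R :=
  (\sum_(1 <= n <oo) ((2 ^- n)%R : R)%:E * circle_mean f (r n))%E.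

Definition hardy_sqnorm (R : realType) (f : R[i] -> R[i]) : \bar R :=
  ereal_sup [set circle_mean f rho | rho in [set rho : R | 0 <= rho < 1]].

Definition hardy (R : realType) : set (R[i] -> R[i]) :=
  [set f | analytic_disk f /\ (hardy_sqnorm f < +oo)%E].

(* In what follows a Hilbert space of analytic functions is given by its
   underlying set H together with its squared norm N. *)
Definition carleson_bound (R : realType) (H : set (R[i] -> R[i]))
    (N : (R[i] -> R[i]) -> \bar R) (mu : set (plane R) -> \bar R) (C : R) :
    Prop :=
  0 < C /\ forall f, H f ->
    (disk_integral mu (fun z => (modulus (f z) ^+ 2)%:E) <= C%:E * N f)%E.

Definition carleson (R : realType) (H : set (R[i] -> R[i]))
    (N : (R[i] -> R[i]) -> \bar R) (mu : set (plane R) -> \bar R) : Prop :=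
  exists C : R, carleson_bound H N mu C.

Definition carleson_constant (R : realType) (H : set (R[i] -> R[i]))
    (N : (R[i] -> R[i]) -> \bar R) (mu : set (plane R) -> \bar R) : R :=
  inf [set C | carleson_bound H N mu C].

Definition annulus (R : realType) (r : nat -> R) (n : nat) : set (plane R) :=
  [set p | r n <= modulus (cplx p) < r n.+1].

Lemma measurable_annulus (R : realType) (r : nat -> R) (n : nat) :
  measurable (annulus r n).
Proof.
have mf : measurable_fun setT (fun p : plane R => modulus (cplx p)).
  apply: (@measurableT_comp _ _ _ _ _ _ (@Num.sqrt R) _
    (fun p : plane R => p.1 ^+ 2 + p.2 ^+ 2)).
    by apply: continuous_measurable_fun; exact: sqrt_continuous.
  by apply: measurable_funD; apply: measurable_funX.
rewrite (_ : annulus r n =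
    setT `&` (fun p : plane R => modulus (cplx p)) @^-1` `[r n, r n.+1[).
  exact: mf.
by rewrite setTI; apply/seteqP; split => p /=; rewrite in_itv.
Qed.

Definition annulus_part (R : realType)
    (mu : {measure set (plane R) -> \bar R}) (r : nat -> R) (n : nat) :
    {measure set (plane R) -> \bar R} :=
  mrestr mu (measurable_annulus r n).

(* Main.v *)
(* Sufficiency. The tail of an admissible weight is doubling, so for some k one has
   1 - r_(n+k) <= (1 - r_n) / 2.  With rho = r_(n+1+k) the Szego kernel of the disk
   |z| < rho factors as
     1 / (1 - x / rho^2) = 1 / (1 - x) * (1 + sum_(j >= 1) (1 - rho^2) rho^(-2j) x^j),
   x = z conj(u), where the second factor has nonnegative coefficients and is at most
   2 at x = |z|^2 for |z| < r_(n+1).  By the Schur product theorem, used in the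
   explicit form of [schur_decomposition], a Carleson bound for H^2(D) on the annulus
   Omega_n is also one, up to a factor 2, for H^2(rho D); summing over n gives
   the bound by the Bergman norm.

   Necessity. The Bergman bound is applied to z^N f with N about 1 / (2 (1 - r_n)):
   |z|^N >= 1/2 on Omega_n, whereas ||z^N f||_w^2 <= C 2^-n ||f||_(H^2)^2, because
   r_i^(2N) decays faster than any power of (1 - r_n) / (1 - r_i).

   Both arguments are carried out on polynomials.  A function that is merely complex
   differentiable is approximated by polynomials with controlled coefficients by means
   of Goursat's bisection argument, the Cauchy formula, and Bessel's inequality. *)

Require Import Defs.
From HB Require Import structures.
From mathcomp Require Import all_boot all_order all_algebra.
From mathcomp Require Import all_classical all_reals all_analysis.
From mathcomp Require Import complex.
From mathcomp Require Import measurable_realfun ring lra.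

Import Order.TTheory GRing.Theory Num.Theory.
Import numFieldNormedType.Exports.
Local Open Scope classical_set_scope.
Local Open Scope ring_scope.

(** * Complex numbers and integrals of complex-valued functions *)

(** A function of A^2_w need not belong to H^2, so the hypothesis on Omega_n cannot be applied to f
    itself. Applying it to the dilate f(rho z) would not help either: it controls f at the displaced
    points rho z, not on Omega_n. The kernel factorization avoids any displacement of the measure.
    The radius rho is one of the r_i because the Bergman norm sees only these circles, and the shift
    by k+1 indices costs no more than the factor 2^(k+1). The requirement 1 - rho <= (1 - r_(n+1)) /
    2 says that 1 - |z| <= 2 (rho - |z|) on Omega_n, and this is the source of the bound 2. Since
    [mu] is an arbitrary measure and f is differentiable only pointwise, each integral bound passes
    from polynomials to f by Fatou's lemma. This requires pointwise convergence of moduli and an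
    upper bound on the coefficients, hence Bessel's inequality and no identity for the norm of f. *)

Section Modulus.
Context {R : realType}.
Implicit Types (z u : R[i]) (x : R).

Lemma modulus_ge0 z : 0 <= modulus z.
Proof. by case: z => a b; rewrite /modulus /= sqrtr_ge0. Qed.

Lemma sqr_modulus z : modulus z ^+ 2 = complex.Re z ^+ 2 + complex.Im z ^+ 2.
Proof. by case: z => a b; rewrite /modulus /= sqr_sqrtr ?addr_ge0 ?sqr_ge0. Qed.

Lemma modulus0 : modulus (0 : R[i]) = 0.
Proof. exact: ComplexField.Normc.normc0. Qed.

Lemma modulus1 : modulus (1 : R[i]) = 1.
Proof. exact: ComplexField.Normc.normc1. Qed.

Lemma modulusM z u : modulus (z * u) = modulus z * modulus u.
Proof. exact: ComplexField.Normc.normcM. Qed.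

Lemma modulusV z : modulus z^-1 = (modulus z)^-1.
Proof. exact: ComplexField.Normc.normcV. Qed.

Lemma modulusN z : modulus (- z) = modulus z.
Proof. exact: normcN. Qed.

Lemma modulusD z u : modulus (z + u) <= modulus z + modulus u.
Proof. exact: le_normcD. Qed.

Lemma modulusB z u : modulus (z - u) = modulus (u - z).
Proof. by rewrite -modulusN opprB. Qed.

Lemma modulus_dist z u : `|modulus z - modulus u| <= modulus (z - u).
Proof.
have h1 := modulusD (z - u) u; have h2 := modulusD (u - z) z.
rewrite subrK in h1; rewrite subrK modulusB in h2.
by rewrite ler_norml; lra.
Qed.

Lemma modulusX z n : modulus (z ^+ n) = modulus z ^+ n.
Proof.
elim: n => [|n IH]; first by rewrite !expr0 modulus1.
by rewrite !exprS modulusM IH.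
Qed.

Lemma modulus_real x : modulus x%:C%C = `|x|.
Proof. by rewrite /modulus /= expr0n /= addr0 sqrtr_sqr. Qed.

Lemma modulus_realp {x} : 0 <= x -> modulus x%:C%C = x.
Proof. by move=> x0; rewrite modulus_real ger0_norm. Qed.

Lemma modulus_eq0 z : modulus z = 0 -> z = 0.
Proof. exact: ComplexField.Normc.eq0_normc. Qed.

Lemma modulus_conj z : modulus (conjc z) = modulus z.
Proof. by case: z => a b; rewrite /modulus /= sqrrN. Qed.

Lemma mulr_conjc z : z * conjc z = (modulus z ^+ 2)%:C%C.
Proof.
rewrite sqr_modulus; case: z => a b /=; apply/eqP.
by rewrite eq_complex /=; apply/andP; split; apply/eqP; ring.
Qed.

Lemma conjc_mul z u : conjc (z * u) = conjc z * conjc u.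
Proof. exact: rmorphM. Qed.

Lemma conjc_sub z u : conjc (z - u) = conjc z - conjc u.
Proof. exact: rmorphB. Qed.

Lemma conjc_exp z n : conjc (z ^+ n) = conjc z ^+ n.
Proof. exact: rmorphXn. Qed.

Lemma conjc_sum (I : Type) (s : seq I) (F : I -> R[i]) :
  conjc (\sum_(i <- s) F i) = \sum_(i <- s) conjc (F i).
Proof. exact: rmorph_sum. Qed.

Lemma normr_Re_le z : `|complex.Re z| <= modulus z.
Proof.
by rewrite -(ler_pXn2r (ltn0Sn 1)) ?nnegrE ?modulus_ge0 // real_normK ?num_real //
  sqr_modulus lerDl sqr_ge0.
Qed.

Lemma normr_Im_le z : `|complex.Im z| <= modulus z.
Proof.
by rewrite -(ler_pXn2r (ltn0Sn 1)) ?nnegrE ?modulus_ge0 // real_normK ?num_real //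
  sqr_modulus lerDr sqr_ge0.
Qed.

Lemma modulus_le_ReIm z : modulus z <= `|complex.Re z| + `|complex.Im z|.
Proof.
rewrite -(ler_pXn2r (ltn0Sn 1)) ?nnegrE ?modulus_ge0 ?addr_ge0 //.
rewrite sqr_modulus -(real_normK (num_real (complex.Re z))).
rewrite -(real_normK (num_real (complex.Im z))).
have := mulr_ge0 (normr_ge0 (complex.Re z)) (normr_ge0 (complex.Im z)); lra.
Qed.

Lemma modulus_sum (I : Type) (s : seq I) (F : I -> R[i]) :
  modulus (\sum_(i <- s) F i) <= \sum_(i <- s) modulus (F i).
Proof.
elim/big_ind2 : _ => //; first by rewrite modulus0.
by move=> a b c d ab cd; apply: (le_trans (modulusD _ _)); exact: lerD.
Qed.

Lemma complex_ReD z u : complex.Re (z + u) = complex.Re z + complex.Re u.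
Proof. by case: z => a b; case: u. Qed.
Lemma complex_ImD z u : complex.Im (z + u) = complex.Im z + complex.Im u.
Proof. by case: z => a b; case: u. Qed.
Lemma complex_ReM z u : complex.Re (z * u) =
  complex.Re z * complex.Re u - complex.Im z * complex.Im u.
Proof. by case: z => a b; case: u. Qed.
Lemma complex_ImM z u : complex.Im (z * u) =
  complex.Re z * complex.Im u + complex.Im z * complex.Re u.
Proof. by case: z => a b; case: u => c d /=; ring. Qed.

Lemma complex_ext z u : complex.Re z = complex.Re u -> complex.Im z = complex.Im u -> z = u.
Proof. by case: z => a b; case: u => c d /= -> ->. Qed.

End Modulus.

(** * Integrals of continuous real functions over a segment *)

Section RealIntegral.
Context {R : realType}.
Implicit Types (f g F : R -> R) (a b m : R).

(** No orientation is attached to the segment: it is empty, and the value is [0], when [b < a]. This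
    is why order hypotheses accompany splitting and the fundamental theorem. *)
Definition rint a b f : R := \int[@lebesgue_measure R]_(x in `[a, b]) f x.

Lemma continuous_integrable a b f : continuous f ->
  (@lebesgue_measure R).-integrable `[a, b] (EFin \o f).
Proof.
move=> cf; apply: continuous_compact_integrable; first exact: segment_compact.
exact: continuous_subspaceT.
Qed.

Lemma rintD a b f g : continuous f -> continuous g ->
  rint a b (fun x => f x + g x) = rint a b f + rint a b g.
Proof. by move=> cf cg; rewrite /rint RintegralD //; exact: continuous_integrable. Qed.

Lemma rintB a b f g : continuous f -> continuous g ->
  rint a b (fun x => f x - g x) = rint a b f - rint a b g.
Proof. by move=> cf cg; rewrite /rint RintegralB //; exact: continuous_integrable. Qed.

Lemma rintZ a b k f : continuous f -> rint a b (fun x => k * f x) = k * rint a b f.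
Proof. by move=> cf; rewrite /rint RintegralZl //; exact: continuous_integrable. Qed.

Lemma rint_split a m b f : continuous f -> a <= m -> m <= b ->
  rint a b f = rint a m f + rint m b f.
Proof.
move=> cf am mb; rewrite /rint.
have := @Rintegral_itvB R f (BLeft a) (BRight b) m (continuous_integrable _ _ _ cf).
rewrite !bnd_simp => /(_ am mb) H.
rewrite -(@Rintegral_itv_obnd_cbnd R m (BRight b)).
  by rewrite -H addrC subrK.
by apply: integrableS (continuous_integrable m b _ cf) => //; exact: subset_itv_oc_cc.
Qed.

Lemma le_rint a b f g : continuous f -> continuous g ->
  (forall x, a <= x <= b -> f x <= g x) -> rint a b f <= rint a b g.
Proof.
move=> cf cg fg; by apply: le_Rintegral => //; exact: continuous_integrable.
Qed.

Lemma rint_cst a b k : a <= b -> rint a b (fun=> k) = k * (b - a).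
Proof.
move=> ab; rewrite /rint Rintegral_cst //= lebesgue_measure_itv /= lte_fin.
by case: ltgtP ab => // -> _; rewrite subrr.
Qed.

Lemma rint_bound a b f M : continuous f -> a <= b ->
  (forall x, a <= x <= b -> `|f x| <= M) -> `|rint a b f| <= M * (b - a).
Proof.
move=> cf ab fM.
have cM k : continuous (fun _ : R => k : R) by move=> x; exact: cvg_cst.
rewrite ler_norml -mulNr -!rint_cst //; apply/andP; split; apply: le_rint => // x xab.
  by have := fM x xab; rewrite ler_norml => /andP[].
by have := fM x xab; rewrite ler_norml => /andP[].
Qed.

Lemma rint_FTC a b f F : continuous f -> a <= b ->
  (forall x : R, is_derive x 1 F (f x)) -> rint a b f = F b - F a.
Proof.
move=> cf ab dF; have [ab'|ba] := ltP a b; last first.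
  have -> : a = b by apply/eqP; rewrite eq_le ab ba.
  by rewrite /rint set_itv1 Rintegral_set1 subrr.
rewrite /rint /Rintegral (@continuous_FTC2 R f F a b) //.
- exact: continuous_subspaceT.
- have cF x : {for x, continuous F}.
    by apply/differentiable_continuous/derivable1_diffP; case: (dF x).
  split.
  + by move=> x _; case: (dF x).
  + by apply: cvg_at_right_filter; exact: cF.
  + by apply: cvg_at_left_filter; exact: cF.
- by move=> x _; rewrite derive1E; case: (dF x).
Qed.

End RealIntegral.

(** * Integrals of complex functions of a real variable *)

Section ComplexIntegral.
Context {R : realType}.
Implicit Types (u v : R -> R[i]) (a b m : R) (k : R[i]).

(** Continuity is asked of the two real components, so that statements on complex integrals reduce
    to statements on [rint]. *)
Definition ccont u :=
  continuous (fun t => complex.Re (u t)) /\ continuous (fun t => complex.Im (u t)).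

Definition cint a b u : R[i] :=
  (rint a b (fun t => complex.Re (u t)) +i* rint a b (fun t => complex.Im (u t)))%C.

Lemma ccontD u v : ccont u -> ccont v -> ccont (fun t => u t + v t).
Proof.
move=> [u1 u2] [v1 v2]; split.
  by under eq_fun do rewrite complex_ReD; move=> x; apply: cvgD; [exact: u1|exact: v1].
by under eq_fun do rewrite complex_ImD; move=> x; apply: cvgD; [exact: u2|exact: v2].
Qed.

Lemma ccontM u v : ccont u -> ccont v -> ccont (fun t => u t * v t).
Proof.
move=> [u1 u2] [v1 v2]; split.
  under eq_fun do rewrite complex_ReM; move=> x; apply: cvgB; apply: cvgM;
    by [exact: u1|exact: v1|exact: u2|exact: v2].
under eq_fun do rewrite complex_ImM; move=> x; apply: cvgD; apply: cvgM;
  by [exact: u1|exact: v1|exact: u2|exact: v2].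
Qed.

Lemma ccont_cst k : ccont (fun=> k).
Proof.
by split; exact: cst_continuous.
Qed.

Lemma ccontX u n : ccont u -> ccont (fun t => u t ^+ n).
Proof.
move=> cu; elim: n => [|n IH]; first by under eq_fun do rewrite expr0; exact: ccont_cst.
by under eq_fun do rewrite exprS; exact: ccontM.
Qed.

Lemma ccont_sum (I : Type) (s : seq I) (F : I -> R -> R[i]) :
  (forall i, ccont (F i)) -> ccont (fun t => \sum_(i <- s) F i t).
Proof.
move=> cF; elim: s => [|i s IH].
  by under eq_fun do rewrite big_nil; exact: ccont_cst.
by under eq_fun do rewrite big_cons; exact: ccontD.
Qed.

Lemma ccont_conj u : ccont u -> ccont (fun t => conjc (u t)).
Proof.
move=> [u1 u2]; split.
  by rewrite (_ : (fun _ => _) = fun t => complex.Re (u t)) //; apply/funext => t; case: (u t).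
rewrite (_ : (fun _ => _) = fun t => - complex.Im (u t)).
  by move=> x; apply: cvgN; exact: u2.
by apply/funext => t; case: (u t).
Qed.

Lemma ccont_real (f : R -> R) : continuous f -> ccont (fun t => (f t)%:C%C).
Proof. by move=> cf; split => //; exact: cst_continuous. Qed.

Lemma cintD a b u v : ccont u -> ccont v ->
  cint a b (fun t => u t + v t) = cint a b u + cint a b v.
Proof.
move=> [u1 u2] [v1 v2]; apply: complex_ext.
  rewrite complex_ReD /cint /= -rintD //; congr rint; by apply/funext => t; rewrite complex_ReD.
by rewrite complex_ImD /cint /= -rintD //; congr rint; apply/funext => t; rewrite complex_ImD.
Qed.

Lemma cintZ a b k u : ccont u -> cint a b (fun t => k * u t) = k * cint a b u.
Proof.
move=> [u1 u2].
have cZ (l : R) (f : R -> R) : continuous f -> continuous (fun t : R => l * f t).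
  by move=> cf x; apply: cvgM; [exact: cvg_cst|exact: cf].
apply: complex_ext.
  rewrite complex_ReM /cint /= -!rintZ // -rintB; try by apply: cZ.
  by congr rint; apply/funext => t; rewrite complex_ReM.
rewrite complex_ImM /cint /= -!rintZ // -rintD; try by apply: cZ.
by congr rint; apply/funext => t; rewrite complex_ImM.
Qed.

Lemma cintB a b u v : ccont u -> ccont v ->
  cint a b (fun t => u t - v t) = cint a b u - cint a b v.
Proof.
move=> cu cv; rewrite -[- cint a b v]mulN1r -cintZ // -cintD //; last first.
  by apply: ccontM => //; exact: ccont_cst.
by congr cint; apply/funext => t; rewrite mulN1r.
Qed.

Lemma cint0 a b : cint a b (fun=> 0) = 0.
Proof.
have := @cintZ a b 0 (fun=> 0) (ccont_cst _).
by under eq_fun do rewrite mul0r; move=> ->; rewrite mul0r.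
Qed.

Lemma cint_sum a b (I : Type) (s : seq I) (F : I -> R -> R[i]) :
  (forall i, ccont (F i)) ->
  cint a b (fun t => \sum_(i <- s) F i t) = \sum_(i <- s) cint a b (F i).
Proof.
move=> cF; elim: s => [|i s IH].
  by rewrite big_nil; under eq_fun do rewrite big_nil; exact: cint0.
rewrite big_cons -IH -cintD //; last exact: ccont_sum.
by congr cint; apply/funext => t; rewrite big_cons.
Qed.

Lemma cint_conj a b u : ccont u -> cint a b (fun t => conjc (u t)) = conjc (cint a b u).
Proof.
move=> [u1 u2]; apply: complex_ext => /=.
  by congr rint; apply/funext => t; case: (u t).
rewrite -mulN1r -rintZ //; congr rint; apply/funext => t; rewrite mulN1r; by case: (u t).
Qed.

Lemma cint_split a m b u : ccont u -> a <= m -> m <= b ->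
  cint a b u = cint a m u + cint m b u.
Proof.
by move=> [u1 u2] am mb; apply: complex_ext; rewrite ?complex_ReD ?complex_ImD /= -rint_split.
Qed.

(** The factor 2 comes from bounding real and imaginary parts separately. Such a fixed factor is
    harmless below, where the bound always serves to show that something is arbitrarily small. *)
Lemma cint_bound a b u M : ccont u -> a <= b ->
  (forall x, a <= x <= b -> modulus (u x) <= M) ->
  modulus (cint a b u) <= 2 * (M * (b - a)).
Proof.
move=> [u1 u2] ab uM; apply: (le_trans (modulus_le_ReIm _)) => /=.
rewrite mulr_natl mulr2n; apply: lerD; apply: rint_bound => // x xab.
  exact: le_trans (normr_Re_le _) (uM _ xab).
exact: le_trans (normr_Im_le _) (uM _ xab).
Qed.

Lemma cint_FTC a b u (F : R -> R[i]) : ccont u -> a <= b ->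
  (forall x : R, is_derive x 1 (fun t => complex.Re (F t)) (complex.Re (u x))) ->
  (forall x : R, is_derive x 1 (fun t => complex.Im (F t)) (complex.Im (u x))) ->
  cint a b u = F b - F a.
Proof.
move=> [u1 u2] ab dR dI; apply: complex_ext => /=.
  by rewrite (rint_FTC _ _ _ _ u1 ab dR) complex_ReD; case: (F a).
by rewrite (rint_FTC _ _ _ _ u2 ab dI) complex_ImD; case: (F a).
Qed.

End ComplexIntegral.

(** * Goursat's lemma and the Cauchy formula *)

Section Goursat.
Context {R : realType}.

Lemma half_pow_lt (e : R) : 0 < e -> exists n, 2 ^- n < e.
Proof.
move=> e0; have [n _ Hn] := near_infty_natSinv_expn_lt (PosNum e0).
by exists n; have := Hn n (leqnn _); rewrite /= div1r.
Qed.

Lemma half_powS n : (2 ^- n.+1 : R) = 2 ^- n / 2.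
Proof. by rewrite exprS invfM mulrC. Qed.

Lemma half_pow_gt0 n : 0 < (2 ^- n : R).
Proof. by rewrite invr_gt0 exprn_gt0. Qed.

(** Each left end [x n] lies below every right end, so the supremum of the left ends belongs to all
    the intervals. *)
Lemma nested_intervals (x : nat -> R) (L : R) : 0 <= L ->
  (forall n, x n <= x n.+1 /\ x n.+1 + L * 2 ^- n.+1 <= x n + L * 2 ^- n) ->
  exists p, forall n, x n <= p <= x n + L * 2 ^- n.
Proof.
move=> L0 H.
have up m n : x m <= x (m + n)%N.
  by elim: n => [|n IH]; rewrite ?addn0 ?addnS // (le_trans IH) //; case: (H (m + n)%N).
have dn m n : x (m + n)%N + L * 2 ^- (m + n) <= x m + L * 2 ^- m.
  elim: n => [|n IH]; first by rewrite addn0.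
  by rewrite addnS (le_trans _ IH) //; case: (H (m + n)%N).
have hge m : 0 <= L * 2 ^- m by rewrite mulr_ge0 // ltW // half_pow_gt0.
have bd m n : x n <= x m + L * 2 ^- m.
  have [nm|/ltnW mn] := leqP n m.
    by rewrite -(subnKC nm) (le_trans (up n (m - n)%N)) // lerDl subnKC.
  by rewrite -(subnKC mn) (le_trans _ (dn m (n - m)%N)) // lerDl.
have hs : has_sup (range x).
  split; first by exists (x 0%N), 0%N.
  by exists (x 0%N + L * 2 ^- 0) => _ [n _ <-].
exists (sup (range x)) => n; apply/andP; split.
  by apply: sup_upper_bound => //; exists n.
by apply: ge_sup; [case: hs|move=> _ [m _ <-]].
Qed.

(** Goursat's bisection, freed from any integrand. Of the four quarters of a rectangle, one carries
    at least a quarter of the value, while the square of the size is divided by exactly 4. At the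
    common point of the nested rectangles, the local bound with a small [e] then forces the value to
    be 0. *)
Lemma rectangle_function_eq0 (I : R -> R -> R -> R -> R) :
  (forall a m b c d, a <= m -> m <= b -> c <= d -> I a b c d = I a m c d + I m b c d) ->
  (forall a b c m d, a <= b -> c <= m -> m <= d -> I a b c d = I a b c m + I a b m d) ->
  (forall x y e, 0 < e -> exists2 del, 0 < del & forall a b c d,
     a <= x <= b -> c <= y <= d -> b - a < del -> d - c < del ->
     `|I a b c d| <= e * (b - a + (d - c)) ^+ 2) ->
  forall a b c d, a <= b -> c <= d -> I a b c d = 0.
Proof.
move=> addx addy loc a b c d ab cd.
set L := b - a; set M := d - c.
have L0 : 0 <= L by rewrite subr_ge0.
have M0 : 0 <= M by rewrite subr_ge0.
pose J n (p : R * R) := `|I p.1 (p.1 + L * 2 ^- n) p.2 (p.2 + M * 2 ^- n)|.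
have step (np : nat * (R * R)) : exists q : R * R,
    J np.1 np.2 / 4 <= J np.1.+1 q /\
    (np.2.1 <= q.1 /\ q.1 + L * 2 ^- np.1.+1 <= np.2.1 + L * 2 ^- np.1) /\
    (np.2.2 <= q.2 /\ q.2 + M * 2 ^- np.1.+1 <= np.2.2 + M * 2 ^- np.1).
  case: np => n [x y] /=; rewrite /J /= half_powS.
  have h0 := half_pow_gt0 n; set h := 2 ^- n in h0 *.
  have l0 : 0 <= L * (h / 2) by rewrite mulr_ge0 // divr_ge0 // ltW.
  have m0 : 0 <= M * (h / 2) by rewrite mulr_ge0 // divr_ge0 // ltW.
  have -> : L * h = L * (h / 2) + L * (h / 2) by field.
  have -> : M * h = M * (h / 2) + M * (h / 2) by field.
  set l := L * (h / 2) in l0 *; set m := M * (h / 2) in m0 *.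
  rewrite !addrA.
  rewrite (addx x (x + l)); try lra.
  rewrite (addy x (x + l) y (y + m)); try lra.
  rewrite (addy (x + l) (x + l + l) y (y + m)); try lra.
  set i1 := I x _ y _; set i2 := I x _ (y + m) _.
  set i3 := I (x + l) _ y _; set i4 := I (x + l) _ (y + m) _.
  have tri : `|i1 + i2 + (i3 + i4)| <= `|i1| + `|i2| + (`|i3| + `|i4|).
    by apply: (le_trans (ler_normD _ _)); apply: lerD; exact: ler_normD.
  case: (lerP (`|i1 + i2 + (i3 + i4)| / 4) `|i1|) => [H1|H1].
    by exists (x, y) => /=; split => //; lra.
  case: (lerP (`|i1 + i2 + (i3 + i4)| / 4) `|i2|) => [H2|H2].
    by exists (x, y + m) => /=; split => //; lra.
  case: (lerP (`|i1 + i2 + (i3 + i4)| / 4) `|i3|) => [H3|H3].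
    by exists (x + l, y) => /=; split => //; lra.
  by exists (x + l, y + m) => /=; split; [rewrite -/i4; lra|lra].
have [nxt Hn] := choice step.
pose s := fix s n : R * R := if n is k.+1 then nxt (k, s k) else (a, c).
have Js n : J 0%N (a, c) / 4 ^+ n <= J n (s n).
  elim: n => [|n IH]; first by rewrite expr0 divr1.
  have [H _] := Hn (n, s n); apply: le_trans H => /=.
  by rewrite exprS invfM [X in _ * X]mulrC mulrA ler_pM2r // invr_gt0.
have [x Hx] := nested_intervals (fun n => (s n).1) L L0 (fun n => (Hn (n, s n)).2.1).
have [y Hy] := nested_intervals (fun n => (s n).2) M M0 (fun n => (Hn (n, s n)).2.2).
have J0 : J 0%N (a, c) = `|I a b c d|.
  by rewrite /J /= expr0 invr1 !mulr1 /L /M !subrKC.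
apply/eqP; rewrite -normr_eq0; apply/eqP.
have [//|nz] := eqVneq (`|I a b c d|) 0; exfalso.
have I0 : 0 < `|I a b c d| by rewrite lt_neqAle eq_sym nz normr_ge0.
set w := `|I a b c d| in I0 J0.
have P0 : 0 < (L + M) ^+ 2 + 1 by have := sqr_ge0 (L + M); lra.
(* With this tolerance the bound at a fine level becomes [w <= w (L + M)^2 / ((L + M)^2 + 1)], which
   is false for [w > 0]. The [+ 1] covers degenerate rectangles. *)
have e0 : 0 < w / ((L + M) ^+ 2 + 1) by rewrite divr_gt0.
have [del del0 Hdel] := loc x y _ e0.
have [n hn] := half_pow_lt (del / (L + M + 1)) ltac:(apply: divr_gt0 => //; lra).
have h0 := half_pow_gt0 n.
have hlt : 2 ^- n * (L + M + 1) < del by rewrite -ltr_pdivlMr //; lra.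
have := Js n; rewrite J0 => /le_trans /(_ (Hdel _ _ _ _ (Hx n) (Hy n) _ _)).
rewrite !(addrC (_ n).1) !(addrC (_ n).2) !addrK -mulrDl exprMn.
have hM0 : 0 <= M * 2 ^- n by rewrite mulr_ge0 // ltW.
have hL0 : 0 <= L * 2 ^- n by rewrite mulr_ge0 // ltW.
have -> : (2 ^- n : R) ^+ 2 = 4 ^- n.
  by rewrite -exprVn -exprM mulnC exprM -exprVn; congr (_ ^+ n); field.
rewrite mulrA ler_pM2r ?invr_gt0 ?exprn_gt0 // => H.
have : w <= w / ((L + M) ^+ 2 + 1) * (L + M) ^+ 2 by apply: H; lra.
rewrite mulrAC ler_pdivlMr // ler_pM2l //; lra.
Qed.

End Goursat.

(** * Cauchy's formula on the unit circle *)

Section Cauchy.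
Context {R : realType}.

(** First-order approximation measured by the real modulus, the form in which Goursat's argument
    consumes differentiability. *)
Definition cdiff (F : R[i] -> R[i]) (z : R[i]) := exists d : R[i],
  forall e : R, 0 < e -> exists2 del : R, 0 < del & forall u : R[i],
    modulus (u - z) < del -> modulus (F u - F z - d * (u - z)) <= e * modulus (u - z).

Lemma cdiff_lipschitz F z : cdiff F z -> exists K del : R, [/\ 0 < K, 0 < del &
  forall u, modulus (u - z) < del -> modulus (F u - F z) <= K * modulus (u - z)].
Proof.
move=> [d /(_ 1 ltr01) [del del0 H]]; exists (1 + modulus d), del.
split => //; first by rewrite ltr_wpDr ?modulus_ge0.
move=> u /H Hu; rewrite -(subrK (d * (u - z)) (F u - F z)) mulrDl -modulusM.
by apply: (le_trans (modulusD _ _)); apply: lerD.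
Qed.

Lemma ccont_near (u : R -> R[i]) x (e : R) : ccont u -> 0 < e ->
  \forall t \near x, modulus (u t - u x) < e.
Proof.
move=> [u1 u2] e0.
have e2 : 0 < e / 2 by rewrite divr_gt0.
have /cvgrPdist_lt /(_ _ e2) h1 := u1 x.
have /cvgrPdist_lt /(_ _ e2) h2 := u2 x.
near=> t; apply: (le_lt_trans (modulus_le_ReIm _)).
have H1 : `|complex.Re (u x) - complex.Re (u t)| < e / 2 by near: t.
have H2 : `|complex.Im (u x) - complex.Im (u t)| < e / 2 by near: t.
rewrite distrC in H1; rewrite distrC in H2.
rewrite !(complex_ReD, complex_ImD); case: (u x) H1 H2 => a b /=; lra.
Unshelve. all: by end_near. Qed.

Lemma ccont_comp (F : R[i] -> R[i]) (u : R -> R[i]) :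
  (forall t, cdiff F (u t)) -> ccont u -> ccont (fun t => F (u t)).
Proof.
move=> dF cu.
have key x (e : R) : 0 < e -> \forall t \near x, modulus (F (u t) - F (u x)) < e.
  move=> e0; have [K [del [K0 del0 H]]] := cdiff_lipschitz _ _ (dF x).
  have m0 : 0 < Num.min del (e / K) by rewrite lt_min del0 divr_gt0.
  near=> t.
  have : modulus (u t - u x) < Num.min del (e / K) by near: t; exact: ccont_near.
  rewrite lt_min => /andP[h1 h2]; apply: (le_lt_trans (H _ h1)).
  by rewrite mulrC -ltr_pdivlMr.
split => x; apply/cvgrPdist_lt => e e0; near=> t; rewrite distrC;
  (have : modulus (F (u t) - F (u x)) < e by near: t; exact: key);
  apply: le_lt_trans.
  by apply: le_trans (normr_Re_le _); rewrite complex_ReD; case: (F (u x)).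
by apply: le_trans (normr_Im_le _); rewrite complex_ImD; case: (F (u x)).
Unshelve. all: by end_near. Qed.

Lemma ccontV (u : R -> R[i]) : (forall t, u t != 0) -> ccont u -> ccont (fun t => (u t)^-1).
Proof.
move=> u0 cu.
have uE t : (u t)^-1 = conjc (u t) * ((modulus (u t) ^+ 2)^-1)%:C%C.
  apply: (mulfI (u0 t)); rewrite divff // mulrA mulr_conjc -rmorphM divff ?rmorph1 //.
  by rewrite sqrf_eq0; apply: contra (u0 t) => /eqP/modulus_eq0 ->.
under eq_fun do rewrite uE; apply: ccontM; first exact: ccont_conj.
apply: ccont_real; under eq_fun do rewrite sqr_modulus.
case: (cu) => u1 u2 x; apply: cvgV; last first.
  by apply: cvgD; rewrite !expr2; apply: cvgM; (exact: u1 || exact: u2).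
by rewrite -sqr_modulus sqrf_eq0; apply: contra (u0 x) => /eqP/modulus_eq0 ->.
Qed.

Definition eit (t : R) : R[i] := (cos t +i* sin t)%C.

Lemma ccont_eit : ccont eit.
Proof. by split => /=; [exact: continuous_cos|exact: continuous_sin]. Qed.

Lemma modulus_eit t : modulus (eit t) = 1.
Proof. by rewrite /modulus /= cos2Dsin2 sqrtr1. Qed.

Lemma eit_conj t : eit t * conjc (eit t) = 1.
Proof. by rewrite mulr_conjc modulus_eit expr1n. Qed.

Lemma ler_dist_cos (s t : R) : `|cos t - cos s| <= `|t - s|.
Proof.
wlog st : s t / s <= t.
  move=> H; have [st|/ltW ts] := leP s t; first exact: H.
  by rewrite distrC [leRHS]distrC; exact: H.
have cs : continuous (fun x : R => - sin x).
  by move=> x; apply: cvgN; exact: continuous_sin.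
rewrite -(rint_FTC s t (fun x => - sin x) cos) //.
rewrite [leRHS]ger0_norm ?subr_ge0 // -[leRHS]mul1r; apply: rint_bound => // x _.
by rewrite normrN ler_norml sin_geN1 sin_le1.
Qed.

Lemma ler_dist_sin (s t : R) : `|sin t - sin s| <= `|t - s|.
Proof.
wlog st : s t / s <= t.
  move=> H; have [st|/ltW ts] := leP s t; first exact: H.
  by rewrite distrC [leRHS]distrC; exact: H.
rewrite -(rint_FTC s t cos sin) //; last exact: continuous_cos.
rewrite [leRHS]ger0_norm ?subr_ge0 // -[leRHS]mul1r; apply: rint_bound => //.
  exact: continuous_cos.
by move=> x _; rewrite ler_norml cos_geN1 cos_le1.
Qed.

Lemma modulus_eitB s t : modulus (eit t - eit s) <= 2 * `|t - s|.
Proof.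
apply: (le_trans (modulus_le_ReIm _)) => /=; rewrite mulr_natl mulr2n.
by apply: lerD; [exact: ler_dist_cos|exact: ler_dist_sin].
Qed.

Section CauchyPoint.
Context (F : R[i] -> R[i]) (z : R[i]).
Hypothesis dF : forall u, modulus u <= 1 -> cdiff F u.
Hypothesis z1 : modulus z < 1.

(** [Phi] contracts the unit circle to [z] along segments: [Phi 0 t] is [eit t], and [Phi s t] tends
    to [z] as [s] grows. As [lam] is positive on the whole line, [Phi] never meets [z], so no
    rectangle in the [(s, t)] plane contains a singularity. [A] is the logarithmic derivative of
    [lam], and ['i * Q] that of [kap]. *)
Let kap t := eit t - z.
Let lam (s : R) : R := (1 + s ^+ 2)^-1.
Let Q t := eit t / (eit t - z).
Let K := (1 - modulus z)^-1.
Let Phi s t := z + (lam s)%:C%C * kap t.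
Let A (s : R) : R := - (2 * s) * lam s.

Let K1 : 1 <= K.
Proof. by rewrite invf_ge1 ?subr_gt0 // gerBl modulus_ge0. Qed.

Let kap_ge t : 1 - modulus z <= modulus (kap t).
Proof.
rewrite lerBlDr -(modulus_eit t) -{1}(subrK z (eit t)); exact: modulusD.
Qed.

Let kap0 t : kap t != 0.
Proof.
apply/eqP => k0; have := kap_ge t; rewrite k0 modulus0 subr_le0.
by rewrite leNgt z1.
Qed.

Let ccont_kap : ccont kap.
Proof. by apply: ccontD; [exact: ccont_eit|exact: ccont_cst]. Qed.

Let ccontQ : ccont Q.
Proof. by apply: ccontM; [exact: ccont_eit|exact: ccontV]. Qed.

Let modulusQ t : modulus (Q t) <= K.
Proof.
rewrite /Q modulusM modulusV modulus_eit mul1r /K lef_pV2 ?kap_ge // posrE ?subr_gt0 //.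
by rewrite (lt_le_trans _ (kap_ge t)) // subr_gt0.
Qed.

Let s21 (s : R) : 0 < 1 + s ^+ 2.
Proof. by have := sqr_ge0 s; lra. Qed.

Let lam_gt0 s : 0 < lam s.
Proof. by rewrite invr_gt0. Qed.

Let lam_le1 s : lam s <= 1.
Proof. by rewrite invf_le1 // lerDl sqr_ge0. Qed.

Let is_derive_lam (s : R) : is_derive s 1 lam (A s * lam s).
Proof.
have H : is_derive s 1 (fun x : R => 1 + x ^+ 2) (2 * s).
  by apply: is_derive_eq; rewrite /GRing.scale /=; ring.
have fs0 := lt0r_neq0 (s21 s).
apply: (is_derive_eq (@is_deriveV _ (fun x : R => 1 + x ^+ 2) _ _ _ fs0 H)).
by rewrite /A /lam /GRing.scale /=; field; rewrite lt0r_neq0.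
Qed.

Let continuous_lam : continuous lam.
Proof.
move=> s; apply/differentiable_continuous/derivable1_diffP.
by case: (is_derive_lam s).
Qed.

Let continuousA : continuous A.
Proof.
move=> s; apply: cvgM; last exact: continuous_lam.
by apply: cvgN; apply: cvgM; [exact: cvg_cst|exact: cvg_id].
Qed.

Let A_le1 s : `|A s| <= 1.
Proof.
rewrite /A /lam normrM normrV ?unitfE ?lt0r_neq0 // [`|1 + _|]gtr0_norm //.
rewrite ler_pdivrMr // mul1r normrN normrM ger0_norm //.
by rewrite -(real_normK (num_real s)); have := sqr_ge0 (`|s| - 1); lra.
Qed.

Let lam_lip s s0 : `|lam s - lam s0| <= `|s - s0|.
Proof.
wlog ss : s s0 / s0 <= s.
  move=> H; have [ss|/ltW ss] := leP s0 s; first exact: H.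
  by rewrite distrC [leRHS]distrC; exact: H.
have cA : continuous (fun x => A x * lam x).
  by move=> x; apply: cvgM; [exact: continuousA|exact: continuous_lam].
rewrite -(rint_FTC s0 s _ lam cA ss is_derive_lam) [leRHS]ger0_norm ?subr_ge0 // -[leRHS]mul1r.
apply: rint_bound => // x _; rewrite normrM [`|lam x|]gtr0_norm //.
by rewrite -[leRHS]mul1r; apply: ler_pM => //; rewrite ltW.
Qed.

Let Phi_le1 s t : modulus (Phi s t) <= 1.
Proof.
have -> : Phi s t = (1 - lam s)%:C%C * z + (lam s)%:C%C * eit t.
  by rewrite /Phi /kap rmorphB rmorph1; ring.
apply: (le_trans (modulusD _ _)); rewrite !modulusM modulus_eit.
rewrite (modulus_realp (ltW (lam_gt0 s))) modulus_realp ?subr_ge0 // mulr1.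
have : (1 - lam s) * modulus z <= (1 - lam s) * 1 by rewrite ler_wpM2l ?subr_ge0 // ltW.
lra.
Qed.

Let ccontPhi1 t : ccont (Phi^~ t).
Proof.
apply: ccontD; first exact: ccont_cst.
by apply: ccontM; [exact: ccont_real|exact: ccont_cst].
Qed.

Let ccontPhi2 s : ccont (Phi s).
Proof.
apply: ccontD; first exact: ccont_cst.
by apply: ccontM; [exact: ccont_cst|].
Qed.

(* The integral of the differential form g (lam' / lam ds + kap' / kap dt),
   which for g = F o Phi is the pullback by Phi of F(u) du / (u - z), along the
   boundary of the rectangle [a, b] x [c, d]. *)
Let bdry (g : R -> R -> R[i]) (a b c d : R) : R[i] :=
  cint a b (fun s => g s c * (A s)%:C%C) + cint c d (fun t => g b t * ('i%C * Q t))
  - (cint a b (fun s => g s d * (A s)%:C%C) + cint c d (fun t => g a t * ('i%C * Q t))).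

Let sep_cont (g : R -> R -> R[i]) :=
  (forall t, ccont (g^~ t)) /\ (forall s, ccont (g s)).

Let ccontgA g t : sep_cont g -> ccont (fun s => g s t * (A s)%:C%C).
Proof. by case=> g1 g2; apply: ccontM => //; exact: ccont_real. Qed.

Let ccontgQ g s : sep_cont g -> ccont (fun t => g s t * ('i%C * Q t)).
Proof.
by case=> g1 g2; apply: ccontM => //; apply: ccontM => //; exact: ccont_cst.
Qed.

Let bdryD g1 g2 a b c d : sep_cont g1 -> sep_cont g2 ->
  bdry (fun s t => g1 s t + g2 s t) a b c d = bdry g1 a b c d + bdry g2 a b c d.
Proof.
move=> h1 h2; rewrite /bdry.
have eA t : cint a b (fun s => (g1 s t + g2 s t) * (A s)%:C%C) =
    cint a b (fun s => g1 s t * (A s)%:C%C) + cint a b (fun s => g2 s t * (A s)%:C%C).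
  rewrite -cintD; try exact: ccontgA.
  by congr cint; apply/funext => s; rewrite mulrDl.
have eQ s : cint c d (fun t => (g1 s t + g2 s t) * ('i%C * Q t)) =
    cint c d (fun t => g1 s t * ('i%C * Q t)) + cint c d (fun t => g2 s t * ('i%C * Q t)).
  rewrite -cintD; try exact: ccontgQ.
  by congr cint; apply/funext => t; rewrite mulrDl.
by rewrite !eA !eQ; ring.
Qed.

(** [A] depends on [s] alone and [Q] on [t] alone, so opposite sides cancel. *)
Let bdry_cst k a b c d : bdry (fun _ _ => k) a b c d = 0.
Proof. exact: subrr. Qed.

(** [Phi s t - z] is [lam s] times [kap t], so the form is the exact differential of
    [k * lam * kap]. *)
Let bdry_linear k a b c d : a <= b -> c <= d ->
  bdry (fun s t => k * (Phi s t - z)) a b c d = 0.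
Proof.
move=> ab cd.
have eA t : cint a b (fun s => k * (Phi s t - z) * (A s)%:C%C) =
    k * kap t * ((lam b)%:C%C - (lam a)%:C%C).
  have cAl : ccont (fun s => (A s * lam s)%:C%C).
    by apply: ccont_real => x; apply: cvgM; [exact: continuousA|exact: continuous_lam].
  have dI (x : R) : is_derive x 1 (fun=> 0 : R) 0 by exact: is_derive_cst.
  rewrite -(cint_FTC a b _ (fun s => (lam s)%:C%C) cAl ab is_derive_lam dI) -cintZ //.
  by congr cint; apply/funext => s; rewrite /Phi (rmorphM _ (A s)) -/(A s); ring.
have eQ s : cint c d (fun t => k * (Phi s t - z) * ('i%C * Q t)) =
    k * (lam s)%:C%C * (kap d - kap c).
  have ciE : ccont (fun t => 'i%C * eit t).
    by apply: ccontM; [exact: ccont_cst|exact: ccont_eit].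
  have dR (x : R) : is_derive x 1 (fun t => complex.Re (kap t)) (complex.Re ('i%C * eit x)).
    rewrite /kap; under eq_fun do rewrite complex_ReD.
    by apply: is_derive_eq; rewrite /= mul0r mul1r sub0r addr0.
  have dI (x : R) : is_derive x 1 (fun t => complex.Im (kap t)) (complex.Im ('i%C * eit x)).
    rewrite /kap; under eq_fun do rewrite complex_ImD.
    by apply: is_derive_eq; rewrite /= mul0r mul1r add0r addr0.
  rewrite -(cint_FTC c d _ kap ciE cd dR dI) -cintZ //.
  congr cint; apply/funext => t; rewrite /Phi /Q; have := kap0 t; rewrite /kap => h.
  by field.
by rewrite /bdry !eA !eQ; ring.
Qed.

Let bdry_bound g a b c d M : sep_cont g -> a <= b -> c <= d ->
  (forall s t, a <= s <= b -> c <= t <= d -> modulus (g s t) <= M) ->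
  modulus (bdry g a b c d) <= 4 * (M * K * (b - a + (d - c))).
Proof.
move=> sg ab cd gM.
have M0 : 0 <= M by apply: le_trans (modulus_ge0 (g a c)) (gM _ _ _ _); rewrite lexx.
have bA t : c <= t <= d ->
    modulus (cint a b (fun s => g s t * (A s)%:C%C)) <= 2 * (M * K * (b - a)).
  move=> tcd; apply: cint_bound => //; first exact: ccontgA.
  move=> s sab; rewrite modulusM modulus_real; apply: ler_pM => //.
  - exact: modulus_ge0.
  - exact: gM.
  - exact: le_trans (A_le1 s) K1.
have bQ s : a <= s <= b ->
    modulus (cint c d (fun t => g s t * ('i%C * Q t))) <= 2 * (M * K * (d - c)).
  move=> sab; apply: cint_bound => //; first exact: ccontgQ.
  move=> t tcd; rewrite 2!modulusM; apply: ler_pM => //.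
  - exact: modulus_ge0.
  - by rewrite mulr_ge0 ?modulus_ge0.
  - exact: gM.
  - by rewrite (_ : modulus 'i%C = 1) ?mul1r // /modulus /= expr0n expr1n add0r sqrtr1.
have h1 := bA c ltac:(rewrite lexx //); have h2 := bA d ltac:(rewrite lexx andbT //).
have h3 := bQ a ltac:(rewrite lexx //); have h4 := bQ b ltac:(rewrite lexx andbT //).
rewrite /bdry; apply: (le_trans (modulusD _ _)); rewrite modulusN.
have h5 := modulusD (cint a b (fun s => g s c * (A s)%:C%C))
  (cint c d (fun t => g b t * ('i%C * Q t))).
have h6 := modulusD (cint a b (fun s => g s d * (A s)%:C%C))
  (cint c d (fun t => g a t * ('i%C * Q t))).
lra.
Qed.

Let h s t := F (Phi s t).

Let sep_cont_h : sep_cont h.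
Proof.
split=> x; apply: ccont_comp; by [move=> y; exact/dF/Phi_le1|].
Qed.

(** The affine part of [h] at [Phi x y] integrates to zero, which leaves the remainder [r]. It is at
    most the tolerance times the displacement of [Phi], itself at most twice the size of the
    rectangle; [bdry_bound] supplies [4 * K] and a second factor of the size. Hence the tolerance
    [e / (8 * K)]. *)
Let bdry_local x y e : 0 < e -> exists2 del, 0 < del & forall a b c d,
     a <= x <= b -> c <= y <= d -> b - a < del -> d - c < del ->
     modulus (bdry h a b c d) <= e * (b - a + (d - c)) ^+ 2.
Proof.
move=> e0; have [D HD] := dF _ (Phi_le1 x y).
have K0 : 0 < K by exact: lt_le_trans ltr01 K1.
have [del del0 H] := HD (e / (8 * K)) ltac:(rewrite divr_gt0 // mulr_gt0 //).
exists (del / 4); first by rewrite divr_gt0.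
move=> a b c d /andP[ax xb] /andP[cy yd] bad dcd.
have dPhi s t : a <= s <= b -> c <= t <= d ->
    modulus (Phi s t - Phi x y) <= 2 * (b - a + (d - c)).
  move=> /andP[as_ sb] /andP[ct td].
  have -> : Phi s t - Phi x y =
      (lam s - lam x)%:C%C * kap t + (lam x)%:C%C * (eit t - eit y).
    by rewrite /Phi /kap rmorphB; ring.
  apply: (le_trans (modulusD _ _)); rewrite !modulusM modulus_real (modulus_realp (ltW (lam_gt0 x))).
  have k2 : modulus (kap t) <= 2.
    apply: (le_trans (modulusD _ _)); rewrite modulusN modulus_eit.
    by have := ltW z1; lra.
  rewrite mulrDr; apply: lerD.
    rewrite mulrC; apply: ler_pM; rewrite ?modulus_ge0 //.
    apply: (le_trans (lam_lip _ _)); rewrite ler_norml; lra.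
  rewrite -[leRHS]mul1r; apply: ler_pM => //; [exact: ltW|exact: modulus_ge0|].
  apply: (le_trans (modulus_eitB _ _)); rewrite ler_pM2l // ler_norml; lra.
pose r s t := h s t - h x y - D * (Phi s t - Phi x y).
have rE s t : h s t = (h x y - D * (Phi x y - z)) + (D * (Phi s t - z) + r s t).
  by rewrite /r; ring.
have cl k : sep_cont (fun s t => k * (Phi s t - z)).
  split=> w; (apply: ccontM; first exact: ccont_cst);
    (apply: ccontD; last exact: ccont_cst).
    exact: ccontPhi1.
  exact: ccontPhi2.
have cr : sep_cont r.
  have [s1 s2] := sep_cont_h.
  have -> : r = fun s t =>
      h s t + (- (h x y - D * (Phi x y - z)) + (- D * (Phi s t - z))).
    by apply/funext => s; apply/funext => t; rewrite /r; ring.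
  have [c1 c2] := cl (- D).
  split=> w; apply: ccontD => //;
    apply: ccontD => //; exact: ccont_cst.
have -> : bdry h a b c d = bdry r a b c d.
  rewrite (_ : h = fun s t => (h x y - D * (Phi x y - z)) + (D * (Phi s t - z) + r s t)).
    rewrite (bdryD (fun _ _ => h x y - D * (Phi x y - z))); last first.
    - have [c1 c2] := cl D; have [r1 r2] := cr; by split=> w; apply: ccontD.
    - by split=> w; exact: ccont_cst.
    by rewrite (bdryD (fun s t => D * (Phi s t - z)) r) // bdry_cst bdry_linear ?add0r //; lra.
  by apply/funext => s; apply/funext => t; exact: rE.
apply: (le_trans (bdry_bound r a b c d (e / (8 * K) * (2 * (b - a + (d - c)))) cr _ _ _)).
- lra.
- lra.
- move=> s t sab tcd; have hP := dPhi s t sab tcd.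
  apply: (le_trans (H _ _)); first by apply: (le_lt_trans hP); lra.
  by rewrite ler_pM2l // divr_gt0 // mulr_gt0.
- by rewrite le_eqVlt; apply/orP; left; apply/eqP; field; rewrite lt0r_neq0.
Qed.

Let bdry_eq0 a b c d : a <= b -> c <= d -> bdry h a b c d = 0.
Proof.
have rx (x1 x2 q m y1 y2 p : R[i]) : x1 + x2 + q - (y1 + y2 + p) =
    x1 + m - (y1 + p) + (x2 + q - (y2 + m)) by ring.
have ry (x1 x2 q m y1 y2 p : R[i]) : q + (x1 + x2) - (p + (y1 + y2)) =
    q + x1 - (m + y1) + (m + x2 - (p + y2)) by ring.
have addx a' m b' c' d' : a' <= m -> m <= b' -> c' <= d' ->
    bdry h a' b' c' d' = bdry h a' m c' d' + bdry h m b' c' d'.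
  move=> am mb cd; rewrite /bdry !(cint_split a' m b') //; exact: ccontgA.
have addy a' b' c' m d' : a' <= b' -> c' <= m -> m <= d' ->
    bdry h a' b' c' d' = bdry h a' b' c' m + bdry h a' b' m d'.
  move=> ab cm md; rewrite /bdry !(cint_split c' m d') //; exact: ccontgQ.
move=> ab cd; apply: complex_ext.
  apply: (rectangle_function_eq0 (fun a b c d => complex.Re (bdry h a b c d))) => //.
  - by move=> *; rewrite -complex_ReD -addx.
  - by move=> *; rewrite -complex_ReD -addy.
  - move=> x y e /(bdry_local x y) [del del0 H]; exists del => // *.
    by apply: le_trans (normr_Re_le _) (H _ _ _ _ _ _ _ _).
apply: (rectangle_function_eq0 (fun a b c d => complex.Im (bdry h a b c d))) => //.
- by move=> *; rewrite -complex_ImD -addx.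
- by move=> *; rewrite -complex_ImD -addy.
- move=> x y e /(bdry_local x y) [del del0 H]; exists del => // *.
  by apply: le_trans (normr_Im_le _) (H _ _ _ _ _ _ _ _).
Qed.

Let pi2 : 0 <= 2 * pi :> R.
Proof. by rewrite mulr_ge0 // pi_ge0. Qed.

(** The integral of [h s t * Q t] over a period does not depend on [s]. At [s = 0] it is the
    left-hand side, and as [s] grows [h s t] tends to [F z]. The integral of [Q] is left unevaluated
    here. *)
Lemma cauchy_formula : cint 0 (2 * pi) (fun t => F (eit t) * Q t) =
  F z * cint 0 (2 * pi) Q.
Proof.
(* On the rectangle [[0, S] x [0, 2 pi]] the sides [t = 0] and [t = 2 pi] cancel by periodicity. *)
have TE S : 0 <= S -> cint 0 (2 * pi) (fun t => h 0 t * Q t) =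
    cint 0 (2 * pi) (fun t => h S t * Q t).
  move=> S0; have := bdry_eq0 0 S 0 (2 * pi) S0 pi2; rewrite /bdry.
  have -> : (fun s => h s (2 * pi) * (A s)%:C%C) = (fun s => h s 0 * (A s)%:C%C).
    apply/funext => s; rewrite /h /Phi /kap /eit cos0 sin0.
    by rewrite mulr_natl cos2pi sin2pi.
  have cQ s : cint 0 (2 * pi) (fun t => h s t * ('i%C * Q t)) =
      'i%C * cint 0 (2 * pi) (fun t => h s t * Q t).
    rewrite -cintZ; last by apply: ccontM => //; case: sep_cont_h.
    by congr cint; apply/funext => t; ring.
  rewrite !cQ opprD addrACA subrr add0r -mulrBr => /eqP.
  rewrite mulf_eq0 => /orP[/eqP/(congr1 (@complex.Im R))/= /eqP|].
    by rewrite oner_eq0.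
  by rewrite subr_eq0 => /eqP ->.
have -> : (fun t => F (eit t) * Q t) = (fun t => h 0 t * Q t).
  apply/funext => t; rewrite /h /Phi /lam expr0n addr0 invr1 rmorph1 mul1r /kap.
  by rewrite addrC subrK.
apply/eqP; rewrite -subr_eq0; apply/eqP; apply: modulus_eq0.
set X := modulus _; apply/eqP; rewrite eq_le modulus_ge0 andbT.
apply/ler_addgt0Pr => e e0; rewrite add0r.
have [L [del [L0 del0 HL]]] := cdiff_lipschitz _ _ (dF _ (ltW z1)).
have K0 : 0 < K by exact: lt_le_trans ltr01 K1.
have P0 : 0 < 2 * pi :> R by rewrite mulr_gt0 // pi_gt0.
(* At [s = m^-1] the factor [lam s] is below [m], which puts [Phi s t] within [2 * m] of [z]. The
   two terms of the minimum ensure the validity of the Lipschitz estimate at [z] and a final error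
   of at most [e]. *)
pose m := Num.min del (e / (2 * K * L * (2 * pi))) / 2.
have m0 : 0 < m.
  by rewrite /m divr_gt0 // lt_min del0 divr_gt0 // mulr_gt0 // mulr_gt0 // mulr_gt0.
have lamS : lam (m^-1) * 2 < 2 * m.
  rewrite mulrC ltr_pM2l // /lam -[ltRHS]invrK ltf_pV2 ?posrE ?invr_gt0 //.
  have m1 : 0 < m^-1 by rewrite invr_gt0.
  by have := sqr_ge0 (m^-1 - 1); lra.
have [mdel me] : 2 * m <= del /\ 2 * m <= e / (2 * K * L * (2 * pi)).
  have -> : 2 * m = Num.min del (e / (2 * K * L * (2 * pi))) by rewrite /m; field.
  by rewrite !ge_min !lexx orbT.
have im0 : 0 <= m^-1 by rewrite invr_ge0 ltW.
rewrite /X (TE m^-1 im0) -cintZ // -cintB; last 2 first.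
- by apply: ccontM => //; case: sep_cont_h.
- by apply: ccontM => //; exact: ccont_cst.
have B := cint_bound 0 (2 * pi) (fun t => h m^-1 t * Q t - F z * Q t) (L * (2 * m) * K).
apply: (le_trans (B _ _ _)) => //.
- apply: ccontD; first by apply: ccontM => //; case: sep_cont_h.
  rewrite (_ : (fun t => - (F z * Q t)) = fun t => - F z * Q t).
    by apply: ccontM => //; exact: ccont_cst.
  by apply/funext => t; rewrite mulNr.
- move=> t _; rewrite -mulrBl modulusM; apply: ler_pM; rewrite ?modulus_ge0 //.
  have dP : modulus (Phi m^-1 t - z) <= 2 * m.
    rewrite /Phi addrC addKr modulusM (modulus_realp (ltW (lam_gt0 _))).
    apply: le_trans (ltW lamS); rewrite ler_pM2l //.
    apply: (le_trans (modulusD _ _)); rewrite modulusN modulus_eit.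
    by have := ltW z1; lra.
  apply: (le_trans (HL _ _)).
    apply: lt_le_trans mdel; rewrite /Phi addrC addKr modulusM (modulus_realp (ltW (lam_gt0 _))).
    apply: le_lt_trans lamS; rewrite ler_pM2l //.
    apply: (le_trans (modulusD _ _)); rewrite modulusN modulus_eit.
    by have := ltW z1; lra.
  by rewrite ler_pM2l.
- rewrite subr0.
  have -> : 2 * (L * (2 * m) * K * (2 * pi)) = (2 * m) * (2 * K * L * (2 * pi)) by ring.
  by rewrite -ler_pdivlMr // mulr_gt0 // mulr_gt0 // mulr_gt0.
Qed.

End CauchyPoint.
End Cauchy.

(** * Fourier and power series *)

Section Fourier.
Context {R : realType}.

Definition cmean (u : R -> R[i]) : R[i] := ((2 * pi)^-1)%:C%C * cint 0 (2 * pi) u.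

Let pi2_gt0 : 0 < 2 * pi :> R.
Proof. by rewrite mulr_gt0 // pi_gt0. Qed.

Lemma cmeanD u v : ccont u -> ccont v -> cmean (fun t => u t + v t) = cmean u + cmean v.
Proof. by move=> cu cv; rewrite /cmean cintD // mulrDr. Qed.

Lemma cmeanB u v : ccont u -> ccont v -> cmean (fun t => u t - v t) = cmean u - cmean v.
Proof. by move=> cu cv; rewrite /cmean cintB // mulrBr. Qed.

Lemma cmeanZ k u : ccont u -> cmean (fun t => k * u t) = k * cmean u.
Proof. by move=> cu; rewrite /cmean cintZ // mulrCA. Qed.

Lemma cmean_sum (I : Type) (s : seq I) (F : I -> R -> R[i]) :
  (forall i, ccont (F i)) ->
  cmean (fun t => \sum_(i <- s) F i t) = \sum_(i <- s) cmean (F i).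
Proof. by move=> cF; rewrite /cmean cint_sum // mulr_sumr. Qed.

Lemma cmean_conj u : ccont u -> cmean (fun t => conjc (u t)) = conjc (cmean u).
Proof. by move=> cu; rewrite /cmean cint_conj // conjc_mul conjc_real. Qed.

Lemma cmean_bound u M : ccont u -> (forall t, 0 <= t <= 2 * pi -> modulus (u t) <= M) ->
  modulus (cmean u) <= 2 * M.
Proof.
move=> cu uM; rewrite /cmean modulusM modulus_realp ?invr_ge0 ?(ltW pi2_gt0) //.
rewrite mulrC ler_pdivrMr // -mulrA -[X in _ * (_ * X)]subr0.
by apply: cint_bound => //; exact: ltW.
Qed.

Lemma eitX (t : R) n : eit t ^+ n = eit (n%:R * t).
Proof.
elim: n => [|n IH]; first by rewrite expr0 mul0r /eit cos0 sin0.
rewrite exprS IH /eit -natr1 mulrDl mul1r [_ + t]addrC cosD sinD; apply: complex_ext => //=.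
by rewrite addrC.
Qed.

Lemma ccont_eitX n : ccont (fun t : R => eit t ^+ n).
Proof. by apply: ccontX; exact: ccont_eit. Qed.

Lemma cmean1 : cmean (fun=> 1) = 1.
Proof.
rewrite /cmean; have -> : cint 0 (2 * pi) (fun _ : R => 1) = (2 * pi)%:C%C.
  by apply: complex_ext; rewrite /cint /= rint_cst ?subr0 ?(ltW pi2_gt0) // ?mul1r ?mul0r.
by rewrite -rmorphM mulVf ?rmorph1 // lt0r_neq0.
Qed.

Lemma cmean_eitX n : cmean (fun t => eit t ^+ n) = (n == 0%N)%:R.
Proof.
case: n => [|n]; first by under eq_fun do rewrite expr0; exact: cmean1.
rewrite /cmean; have n0 : (n.+1%:R : R) != 0 by rewrite pnatr_eq0.
have dR (x : R) : is_derive x 1 (fun t => complex.Re (- 'i%C * (n.+1%:R^-1)%:C%C * eit (n.+1%:R * t)))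
    (complex.Re (eit x ^+ n.+1)).
  rewrite eitX /=; under eq_fun do rewrite !(mul0r, mulr0, oppr0, subr0, add0r, mulN1r, opprK).
  by apply: is_derive_eq; rewrite /GRing.scale /=; field.
have dI (x : R) : is_derive x 1 (fun t => complex.Im (- 'i%C * (n.+1%:R^-1)%:C%C * eit (n.+1%:R * t)))
    (complex.Im (eit x ^+ n.+1)).
  rewrite eitX /=; under eq_fun do rewrite !(mul0r, mulr0, oppr0, subr0, add0r, mulN1r, opprK).
  by apply: is_derive_eq; rewrite /GRing.scale /=; field.
rewrite (cint_FTC 0 (2 * pi) _ _ (ccont_eitX _) (ltW pi2_gt0) dR dI) -mulrBr.
rewrite -(eitX (2 * pi)) -(eitX 0) (_ : eit (2 * pi) = eit 0) ?subrr ?mulr0 //.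
by rewrite /eit mulr_natl cos2pi sin2pi cos0 sin0.
Qed.

Lemma ccont_eit_conjX m n : ccont (fun t : R => eit t ^+ m * conjc (eit t) ^+ n).
Proof.
by apply: ccontM; [exact: ccont_eitX|apply: ccontX; apply: ccont_conj; exact: ccont_eit].
Qed.

Lemma cmean_eit_orthonormal m n :
  cmean (fun t => eit t ^+ m * conjc (eit t) ^+ n) = (m == n)%:R.
Proof.
wlog nm : m n / (n <= m)%N.
  move=> H; have [|/ltnW mn] := leqP n m; first exact: H.
  have -> : (fun t : R => eit t ^+ m * conjc (eit t) ^+ n) =
      (fun t => conjc (eit t ^+ n * conjc (eit t) ^+ m)).
    by apply/funext => t; rewrite conjc_mul !conjc_exp conjcK mulrC.
  by rewrite cmean_conj ?H // ?conjc_nat 1?eq_sym //; exact: ccont_eit_conjX.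
have -> : (fun t : R => eit t ^+ m * conjc (eit t) ^+ n) = (fun t => eit t ^+ (m - n)).
  by apply/funext => t; rewrite -{1}(subnK nm) exprD -mulrA -exprMn eit_conj expr1n mulr1.
by rewrite cmean_eitX subn_eq0 eqn_leq nm andbT.
Qed.

Definition trigpol (c : nat -> R[i]) N (t : R) : R[i] := \sum_(m < N) c m * eit t ^+ m.

Lemma ccont_trigpol c N : ccont (trigpol c N).
Proof.
apply: ccont_sum => m; apply: ccontM; [exact: ccont_cst|exact: ccont_eitX].
Qed.

Lemma cmean_conj_trigpol u c N : ccont u ->
  cmean (fun t => u t * conjc (trigpol c N t)) =
  \sum_(m < N) conjc (c m) * cmean (fun t => u t * conjc (eit t) ^+ m).
Proof.
move=> cu; have cc m : ccont (fun t => u t * conjc (eit t) ^+ m).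
  by apply: ccontM => //; apply: ccontX; apply: ccont_conj; exact: ccont_eit.
under eq_bigr do rewrite -cmeanZ //.
rewrite -cmean_sum; last by move=> i; apply: ccontM; first exact: ccont_cst.
congr cmean; apply/funext => t; rewrite /trigpol conjc_sum mulr_sumr.
by apply: eq_bigr => m _; rewrite conjc_mul conjc_exp; ring.
Qed.

Lemma parseval_trigpol c N :
  cmean (fun t => trigpol c N t * conjc (trigpol c N t)) =
  (\sum_(m < N) modulus (c m) ^+ 2)%:C%C.
Proof.
rewrite cmean_conj_trigpol; last exact: ccont_trigpol.
rewrite rmorph_sum; apply: eq_bigr => m _.
rewrite (_ : (fun t => trigpol c N t * conjc (eit t) ^+ m) =
  (fun t => \sum_(l < N) c l * (eit t ^+ l * conjc (eit t) ^+ m))); last first.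
  by apply/funext => t; rewrite /trigpol mulr_suml; apply: eq_bigr => l _; rewrite mulrA.
rewrite cmean_sum; last first.
  by move=> l; apply: ccontM; [exact: ccont_cst|exact: ccont_eit_conjX].
under eq_bigr => l _.
  rewrite cmeanZ; last exact: ccont_eit_conjX.
  rewrite cmean_eit_orthonormal; over.
rewrite (bigD1 m) //= eqxx mulr1 big1 ?addr0; last first.
  by move=> l lm; rewrite (_ : (l == m :> nat) = false) ?mulr0 //; exact: negbTE.
by rewrite mulrC mulr_conjc.
Qed.

Lemma Re_cmean_ge0 u : ccont u -> 0 <= complex.Re (cmean (fun t => u t * conjc (u t))).
Proof.
move=> cu; rewrite /cmean /= mul0r subr0 mulr_ge0 ?invr_ge0 ?(ltW pi2_gt0) //.
by apply: Rintegral_ge0 => t _; rewrite mulr_conjc /= sqr_ge0.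
Qed.

(** The mean of the squared modulus of [u] minus its partial sum is nonnegative. Only the
    frequencies [0 <= m < N] occur, those of a power series. *)
Lemma bessel u N : ccont u ->
  \sum_(m < N) modulus (cmean (fun t => u t * conjc (eit t) ^+ m)) ^+ 2 <=
  complex.Re (cmean (fun t => u t * conjc (u t))).
Proof.
move=> cu; set c := fun m => cmean (fun t => u t * conjc (eit t) ^+ m).
have cS := ccont_trigpol c N; have cS' := ccont_conj _ cS; have cu' := ccont_conj _ cu.
have uS : cmean (fun t => u t * conjc (trigpol c N t)) =
    (\sum_(m < N) modulus (c m) ^+ 2)%:C%C.
  rewrite cmean_conj_trigpol // rmorph_sum; apply: eq_bigr => m _.
  by rewrite mulrC mulr_conjc.
have Su : cmean (fun t => trigpol c N t * conjc (u t)) =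
    (\sum_(m < N) modulus (c m) ^+ 2)%:C%C.
  rewrite -[RHS]conjc_real -uS -cmean_conj; last exact: ccontM.
  by congr cmean; apply/funext => t; rewrite conjc_mul conjcK mulrC.
have cD : ccont (fun t => u t - trigpol c N t).
  rewrite (_ : (fun t => _) = (fun t => u t + -1 * trigpol c N t)).
    by apply: ccontD => //; apply: ccontM => //; exact: ccont_cst.
  by apply/funext => t; rewrite mulN1r.
have := Re_cmean_ge0 _ cD.
have -> : (fun t => (u t - trigpol c N t) * conjc (u t - trigpol c N t)) =
    (fun t => (u t * conjc (u t) + trigpol c N t * conjc (trigpol c N t)) -
              (u t * conjc (trigpol c N t) + trigpol c N t * conjc (u t))).
  by apply/funext => t; rewrite conjc_sub; ring.
have c1 := ccontM _ _ cu cu'; have c2 := ccontM _ _ cS cS'.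
have c3 := ccontM _ _ cu cS'; have c4 := ccontM _ _ cS cu'.
rewrite (cmeanB _ _ (ccontD _ _ c1 c2) (ccontD _ _ c3 c4)).
rewrite (cmeanD _ _ c1 c2) (cmeanD _ _ c3 c4) parseval_trigpol uS Su -rmorphD !complex_ReD /=.
lra.
Qed.

End Fourier.

(** * Power series of a complex differentiable function *)

Section Expansion.
Context {R : realType}.

Definition pol (b : nat -> R[i]) N (z : R[i]) : R[i] := \sum_(m < N) b m * z ^+ m.

Lemma circle_meanE (f : R[i] -> R[i]) rho : ccont (fun t => f (rho%:C%C * eit t)) ->
  circle_mean f rho =
  (complex.Re (cmean (fun t => f (rho%:C%C * eit t) * conjc (f (rho%:C%C * eit t)))))%:E.
Proof.
move=> cf; rewrite /circle_mean /cmean /= mul0r subr0.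
have cg : continuous (fun t => modulus (f (rho%:C%C * eit t)) ^+ 2).
  have [H _] := ccontM _ _ cf (ccont_conj _ cf).
  rewrite (_ : (fun t => _) = fun t =>
    complex.Re (f (rho%:C%C * eit t) * conjc (f (rho%:C%C * eit t)))) //.
  by apply/funext => t; rewrite mulr_conjc.
have cg' : continuous (fun t => modulus (f (rho%:C%C * eit t)) ^+ 2 / (2 * pi)).
  by move=> x; apply: cvgM; [exact: cg|exact: cvg_cst].
transitivity (rint 0 (2 * pi) (fun t => modulus (f (rho%:C%C * eit t)) ^+ 2 / (2 * pi)))%:E.
  rewrite /rint /Rintegral fineK.
    apply: eq_integral => t _; congr (_ ^+ 2 / _)%:E; congr (modulus (f _)).
    by apply: complex_ext => /=; rewrite mul0r ?subr0 ?addr0.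
  by apply: integrable_fin_num => //; exact: continuous_integrable.
congr EFin; rewrite -rintZ; last by case: (ccontM _ _ cf (ccont_conj _ cf)).
by congr rint; apply/funext => t; rewrite mulr_conjc /= mulrC.
Qed.

Lemma circle_mean_pol b N (rho : R) : 0 <= rho ->
  circle_mean (pol b N) rho = (\sum_(m < N) modulus (b m) ^+ 2 * rho ^+ (2 * m))%:E.
Proof.
move=> r0; have e : (fun t => pol b N (rho%:C%C * eit t)) =
    trigpol (fun m => b m * rho%:C%C ^+ m) N.
  by apply/funext => t; apply: eq_bigr => m _; rewrite exprMn mulrA.
rewrite circle_meanE; last by rewrite e; exact: ccont_trigpol.
under [X in cmean X]eq_fun => t do rewrite [pol _ _ _](congr1 (fun g => g t) e).
rewrite parseval_trigpol; congr EFin; apply: eq_bigr => m _.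
by rewrite modulusM modulusX modulus_realp // exprMn -exprM mulnC.
Qed.

Lemma derivable_cdiff (f : R[i] -> R[i]) z :
  @derivable R[i] (R[i])^o (R[i])^o f z (1 : R[i]) -> cdiff f z.
Proof.
move=> /cvg_ex[l /cvgrPdist_lt H]; exists l => e e0.
have e0' : 0 < e%:C%C by rewrite ltcR.
have := H _ e0'; rewrite near_withinE => /nbhs_ballP[d /= d0 Hd].
have d0' : 0 < complex.Re d by move: d0; rewrite ltcE => /andP[].
have dE : d = (complex.Re d)%:C%C by rewrite RRe_real // gtr0_real.
exists (complex.Re d) => // u ud.
have [->|uz] := eqVneq u z.
  by rewrite !subrr mulr0 subrr modulus0 mulr0.
have uz0 : u - z != 0 by rewrite subr_eq0.
have := Hd (u - z); rewrite /= -ball_normE /= sub0r normrN.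
rewrite normc_def dE ltcR => /(_ _ uz0).
have -> : Num.sqrt (complex.Re (u - z) ^+ 2 + complex.Im (u - z) ^+ 2) = modulus (u - z).
  by case: (u - z).
move=> /(_ ud); rewrite normc_def ltcR => /ltW.
set w := l - _; have -> : Num.sqrt (complex.Re w ^+ 2 + complex.Im w ^+ 2) = modulus w.
  by case: w.
rewrite /w {w} => Hw.
have -> : f u - f z - l * (u - z) = - (u - z) * (l - (u - z)^-1 *: (f ((u - z) *: (1 : (R[i])^o) + z) - f z)).
  rewrite {2}/GRing.scale /= mulr1 subrK {1}/GRing.scale /=.
  by field.
by rewrite modulusM modulusN mulrC ler_wpM2r // modulus_ge0.
Qed.

(** The coefficients are the Fourier coefficients of [f] on the circle of radius [rho]: Bessel's
    inequality gives the first claim, and the Cauchy formula with the geometric expansion of its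
    kernel gives the second. Convergence of moduli is all that the integral bounds require. *)
Lemma power_expansion (f : R[i] -> R[i]) rho : analytic_disk f -> 0 < rho < 1 ->
  exists b : nat -> R[i],
    (forall N, (\sum_(m < N) modulus (b m) ^+ 2)%:E <= circle_mean f rho)%E /\
    forall z, modulus z < 1 -> modulus (pol b N z) @[N --> \oo] --> modulus (f (rho%:C%C * z)).
Proof.
move=> af /andP[r0 r1]; pose F u := f (rho%:C%C * u).
have rC : rho%:C%C != 0 :> R[i] by rewrite eq_complex /= eqxx andbT gt_eqF.
have dF u : modulus u <= 1 -> cdiff F u.
  move=> u1; have [|d H] := derivable_cdiff f (rho%:C%C * u) (af _ _).
    rewrite /unit_disk /= modulusM modulus_realp ?ltW //.
    by rewrite (le_lt_trans _ r1) // ler_piMr // ltW.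
  exists (d * rho%:C%C) => e e0; have [del del0 Hd] := H (e / rho) (divr_gt0 e0 r0).
  exists (del / rho) => [|v]; first exact: divr_gt0.
  rewrite ltr_pdivlMr // => vd; have := Hd (rho%:C%C * v).
  rewrite -mulrBr modulusM (modulus_realp (ltW r0)) [rho * _]mulrC => /(_ vd).
  rewrite (_ : e / rho * _ = e * modulus (v - u)); last by field; rewrite gt_eqF.
  by rewrite /F; congr (modulus _ <= _); ring.
have cu : ccont (fun t => F (eit t)).
  by apply: ccont_comp; [move=> t; apply: dF; rewrite modulus_eit|exact: ccont_eit].
pose b m := cmean (fun t => F (eit t) * conjc (eit t) ^+ m).
exists b; split.
  by move=> N; rewrite circle_meanE // lee_fin; exact: bessel.
move=> z z1; pose Q t := eit t / (eit t - z); pose K := (1 - modulus z)^-1.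
have kge t : 1 - modulus z <= modulus (eit t - z).
  by rewrite lerBlDr -(modulus_eit t) -{1}(subrK z (eit t)); exact: modulusD.
have kgt t : 0 < modulus (eit t - z) by apply: lt_le_trans (kge t); rewrite subr_gt0.
have k0 t : eit t - z != 0.
  by apply/eqP => e; have := kgt t; rewrite e modulus0 ltxx.
have cQ : ccont Q.
  apply: ccontM; first exact: ccont_eit.
  by apply: ccontV => //; apply: ccontD; [exact: ccont_eit|exact: ccont_cst].
have QK t : modulus (Q t) <= K.
  rewrite /Q modulusM modulusV modulus_eit mul1r /K lef_pV2 ?kge // posrE //.
  by rewrite subr_gt0.
have cc m : ccont (fun t : R => conjc (eit t) ^+ m).
  by apply: ccontX; apply: ccont_conj; exact: ccont_eit.
(* [Q t] equals [1 / (1 - x)] with [x = z * conjc (eit t)]: a finite geometric sum and its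
   remainder. *)
have geo N t : Q t = \sum_(m < N) z ^+ m * conjc (eit t) ^+ m + (z * conjc (eit t)) ^+ N * Q t.
  set x := z * conjc (eit t).
  have xQ : (1 - x) * Q t = 1.
    transitivity (eit t * conjc (eit t) * ((eit t - z) / (eit t - z))).
      by rewrite /x /Q -[X in (X - _) * _](eit_conj t); field; exact: k0.
    by rewrite eit_conj divff // mul1r.
  have -> : \sum_(m < N) z ^+ m * conjc (eit t) ^+ m = (1 - x ^+ N) * Q t.
    under eq_bigr do rewrite -exprMn -/x.
    transitivity ((1 - x) * Q t * \sum_(i < N) x ^+ i); first by rewrite xQ mul1r.
    by rewrite mulrAC; congr (_ * _); rewrite -opprB mulNr -subrX1 opprB.
  by rewrite -mulrDl subrK mul1r.
(* Used twice: with [G = 1], to evaluate the mean of [Q] that the Cauchy formula leaves open, and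
   with the boundary values of [F], to identify the limit. *)
have series (G : R -> R[i]) B N : ccont G ->
    (forall t, 0 <= t <= 2 * pi -> modulus (G t) <= B) ->
    modulus (cmean (fun t => G t * Q t) -
      \sum_(m < N) cmean (fun t => G t * conjc (eit t) ^+ m) * z ^+ m) <=
    2 * (B * K) * modulus z ^+ N.
  move=> cG GB.
  have cGm m : ccont (fun t => z ^+ m * (G t * conjc (eit t) ^+ m)).
    by apply: ccontM; [exact: ccont_cst|exact: ccontM].
  have cR : ccont (fun t => G t * ((z * conjc (eit t)) ^+ N * Q t)).
    apply: ccontM => //; apply: ccontM => //; apply: ccontX.
    by apply: ccontM; [exact: ccont_cst|apply: ccont_conj; exact: ccont_eit].
  have -> : cmean (fun t => G t * Q t) =
      \sum_(m < N) cmean (fun t => G t * conjc (eit t) ^+ m) * z ^+ m +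
      cmean (fun t => G t * ((z * conjc (eit t)) ^+ N * Q t)).
    have -> : \sum_(m < N) cmean (fun t => G t * conjc (eit t) ^+ m) * z ^+ m =
        \sum_(m < N) cmean (fun t => z ^+ m * (G t * conjc (eit t) ^+ m)).
      apply: eq_bigr => m _; rewrite mulrC cmeanZ //; exact: ccontM.
    rewrite -cmean_sum // -cmeanD //; last exact: ccont_sum.
    congr cmean; apply/funext => t; rewrite {1}(geo N t) mulrDr mulr_sumr.
    by congr (_ + _); apply: eq_bigr => m _; rewrite mulrCA.
  rewrite addrC addKr -mulrA; apply: cmean_bound => // t tpi.
  rewrite !modulusM modulusX modulusM modulus_conj modulus_eit mulr1.
  rewrite [leRHS]mulrAC -mulrA.
  have B0 : 0 <= B := le_trans (modulus_ge0 _) (GB t tpi).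
  apply: ler_pM => //; rewrite ?mulr_ge0 ?exprn_ge0 ?modulus_ge0 //.
    exact: GB.
  apply: ler_wpM2l; first by apply: exprn_ge0; exact: modulus_ge0.
  by have := QK t; rewrite modulusM modulusV modulus_eit.
have zN : (fun N => modulus z ^+ N) @ \oo --> (0 : R).
  by apply: cvg_expr; rewrite ger0_norm // modulus_ge0.
(* For [G = 1] orthonormality leaves only the term [m = 0], so every nonempty partial sum is 1. *)
have EQ : cmean Q = 1.
  apply/eqP; rewrite -subr_eq0; apply/eqP; apply: modulus_eq0.
  apply/eqP; rewrite eq_le modulus_ge0 andbT.
  have zK : (fun N => 2 * (1 * K) * modulus z ^+ N) @ \oo --> (0 : R).
    by rewrite -[X in _ --> X](mulr0 (2 * (1 * K))); apply: cvgM => //; exact: cvg_cst.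
  apply: (ler_cvg_to _ zK); first by apply: cvg_cst.
  exists 1%N => // -[//|N] _.
  have := series (fun=> 1) 1 N.+1 (ccont_cst _); rewrite modulus1 => /(_ (fun _ _ => lexx 1)).
  under eq_fun do rewrite mul1r.
  rewrite (_ : \sum_(m < N.+1) _ = 1) //.
  rewrite big_ord_recl expr0 mulr1 big1 => [|m _].
    by under eq_fun do rewrite mul1r expr0; rewrite cmean1 addr0.
  rewrite (_ : (fun _ => _) = (fun t => eit t ^+ 0 * conjc (eit t) ^+ (lift ord0 m))) //.
  by rewrite cmean_eit_orthonormal mul0r.
have [B FB] : exists B, forall t, 0 <= t <= 2 * pi -> modulus (F (eit t)) <= B.
  pose g t : R := complex.Re (F (eit t) * conjc (F (eit t))).
  have cg : {within `[0, 2 * pi], continuous g}.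
    by apply: continuous_subspaceT; case: (ccontM _ _ cu (ccont_conj _ cu)).
  have [c _ Hc] := EVT_max (mulr_ge0 (ler0n R 2) (pi_ge0 R)) cg.
  exists (1 + g c) => t tpi; have := Hc t; rewrite in_itv /= => /(_ tpi).
  rewrite /g !mulr_conjc /=; have := sqr_ge0 (modulus (F (eit t)) - 1).
  have := sqr_ge0 (modulus (F (eit t))); lra.
have FE : F z = cmean (fun t => F (eit t) * Q t).
  by rewrite /cmean cauchy_formula // mulrCA -/(cmean Q) EQ mulr1.
have lim0 : (fun N => 2 * (B * K) * modulus z ^+ N) @ \oo --> (0 : R).
  by rewrite -[X in _ --> X](mulr0 (2 * (B * K))); apply: cvgM => //; exact: cvg_cst.
apply/cvgrPdist_le => e e0; move/cvgrPdist_le : lim0 => /(_ e e0); apply: filterS => N.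
rewrite sub0r normrN => /(le_trans (ler_norm _)).
apply: le_trans; apply: le_trans (series _ B N cu FB); rewrite -FE.
exact: modulus_dist.
Qed.

End Expansion.

(** * Comparison with Lebesgue measure; area of annuli *)

Section MeasureComparison.
Context {R : realType}.
Local Notation leb := (@lebesgue_measure R).

(** Lebesgue measure is the infimum of total lengths over countable covers by half-open intervals,
    so subadditivity of [nu] on such covers suffices. *)
Lemma measure_le_lebesgue (nu : {measure set (measurableTypeR R) -> \bar R}) (C : R) :
  0 < C -> (forall a b : R, a < b -> (nu `]a, b]%classic <= (C * (b - a))%:E)%E) ->
  forall A, measurable A -> (nu A <= C%:E * leb A)%E.
Proof.
move=> C0 H A mA.
have H' X : ocitv X -> (nu X <= C%:E * wlength idfun X)%E.
  move=> /ocitvP[->|[[a b] /= ab ->]]; first by rewrite measure0 wlength0 mule0.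
  by rewrite (wlength_itv_bnd _ false false (ltW ab)) -EFinM; exact: H.
rewrite -lee_pdivrMl //; apply: le_ereal_inf_tmp => _ [F [mF AF] <-].
rewrite lee_pdivrMl //.
have mF' i : measurable (F i : set (measurableTypeR R)) by apply: sub_sigma_algebra; exact: mF.
have S : (nu A <= \sum_(k <oo) nu (F k))%E by apply: measure_sigma_subadditive.
apply: (le_trans S).
rewrite -nneseriesZl; last by move=> i _; exact: wlength_ge0.
by apply: lee_nneseries => i *; [exact: measure_ge0|apply: H'; exact: mF].
Qed.

Lemma ge0_integral_le_lebesgue (nu : {measure set (measurableTypeR R) -> \bar R})
    (C : R) (D : set (measurableTypeR R)) (f : R -> \bar R) :
  0 < C -> (forall a b : R, a < b -> (nu `]a, b]%classic <= (C * (b - a))%:E)%E) ->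
  measurable D -> measurable_fun D f -> (forall x, D x -> (0 <= f x)%E) ->
  (\int[nu]_(x in D) f x <= C%:E * \int[leb]_(x in D) f x)%E.
Proof.
move=> C0 H mD mf f0.
rewrite -(ge0_integral_mscale _ mD (NngNum (ltW C0))) //.
rewrite !(integral_mkcond D); apply: ge0_le_measure_integral => //.
- by move=> S mS; exact: measure_le_lebesgue.
- by move=> x; apply: erestrict_ge0.
- exact/(measurable_restrictT _ _).1.
Qed.

(** An inequality in place of a change of variables: the image of [mu] under [phi] is dominated by
    [C] times Lebesgue measure. It serves for the substitution in the doubling condition and for
    polar coordinates. *)
Lemma ge0_integral_comp_le d (X : measurableType d) (mu : {measure set X -> \bar R})
    (phi : X -> measurableTypeR R) (C : R) (D : set (measurableTypeR R))
    (f : R -> \bar R) : measurable_fun setT phi -> 0 < C ->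
  (forall a b : R, a < b -> (mu (phi @^-1` `]a, b]) <= (C * (b - a))%:E)%E) ->
  measurable D -> measurable_fun D f -> (forall x, D x -> (0 <= f x)%E) ->
  (\int[mu]_(x in phi @^-1` D) f (phi x) <= C%:E * \int[leb]_(x in D) f x)%E.
Proof.
move=> mphi C0 H mD mf f0.
pose phi' : {mfun X >-> measurableTypeR R} :=
  HB.pack phi (isMeasurableFun.Build _ _ _ _ _ mphi).
have := ge0_integral_pushforward mphi mu mD mf.
move=> /(_ (fun x xD => f0 x (set_mem xD))) <-.
exact: (ge0_integral_le_lebesgue (pushforward mu phi')).
Qed.

Lemma lebesgue_diameter (A : set (measurableTypeR R)) (x d : R) :
  measurable A -> A `<=` `[x - d, x + d] -> 0 <= d -> (leb A <= (2 * d)%:E)%E.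
Proof.
move=> mA Ad d0; have mI : measurable (`[x - d, x + d]%classic : set (measurableTypeR R)).
  exact: measurable_itv.
apply: (@le_trans _ _ (leb `[x - d, x + d]%classic)).
  by apply: le_measure => //; rewrite inE.
rewrite lebesgue_measure_itv /= lte_fin; case: ifP => // _; last by rewrite lee_fin mulr_ge0.
by rewrite lee_fin; lra.
Qed.

Lemma integral_mrestr d (T : measurableType d) (mu : {measure set T -> \bar R})
    (D A : set T) (mD : measurable D) (f : T -> \bar R) :
  measurable A -> measurable_fun A f -> (forall x, A x -> (0 <= f x)%E) ->
  (\int[mrestr mu mD]_(x in A) f x = \int[mu]_(x in A `&` D) f x)%E.
Proof.
move=> mA mf f0.
have mAD : measurable (A `&` D) by exact: measurableI.
have mAC : measurable (A `\` D) by exact: measurableD.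
rewrite -{1}(setUIDK A D) ge0_integral_setU //; last 3 first.
- by rewrite setUIDK.
- by rewrite setUIDK.
- by apply/disj_setPS => x [[_ Dx] [_]].
rewrite [X in (_ + X)%E](_ : _ = 0%E) ?adde0.
  apply: eq_measure_integral => B mB BAD.
  by rewrite /= /mrestr setIidl // => x /BAD[].
transitivity (\int[mrestr mu mD]_(x in A `\` D) `|f x|)%E.
  by apply: eq_integral => x /[!inE] -[Ax _]; rewrite gee0_abs // f0.
apply: integral_abs_eq0 => //; first by apply: measurable_funS mf => // x [].
rewrite /= /mrestr (_ : (A `\` D) `&` D = set0) ?measure0 //.
by apply/seteqP; split=> // x [[]].
Qed.

End MeasureComparison.

(** * Area of a thin annulus *)

Section Area.
Context {R : realType}.
Local Notation leb := (@lebesgue_measure R).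

Lemma measurable_modulus : measurable_fun setT (fun p : plane R => modulus (cplx p)).
Proof.
apply: (@measurableT_comp _ _ _ _ _ _ (@Num.sqrt R) _
  (fun p : plane R => p.1 ^+ 2 + p.2 ^+ 2)).
  by apply: continuous_measurable_fun; exact: sqrt_continuous.
by apply: measurable_funD; apply: measurable_funX.
Qed.

Lemma preimage_disk : @cplx R @^-1` @unit_disk R =
  (fun p => modulus (cplx p)) @^-1` `[0, 1[.
Proof.
apply/seteqP; split=> p; rewrite /unit_disk /= in_itv /=; last by case/andP.
by move=> p1; apply/andP; split => //; exact: modulus_ge0.
Qed.

Lemma measurable_disk : measurable (@cplx R @^-1` @unit_disk R).
Proof.
rewrite preimage_disk -[X in measurable X]setTI.
by apply: measurable_modulus; [exact: measurableT|exact: measurable_itv].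
Qed.

(** Where [|x| <= |y|], the modulus is at most [2 |y|], so [|y|] varies by at most twice the
    variation of the modulus. The section therefore lies in two intervals centred at [|y0|] and
    [- |y0|], each of length [6 * (b - a)]. *)
Lemma section_bound (x a b : R) (A : set (measurableTypeR R)) : measurable A -> a < b ->
  (forall y, A y -> `|x| <= `|y| /\ a < modulus (x +i* y)%C <= b) ->
  (leb A <= (12 * (b - a))%:E)%E.
Proof.
move=> mA ab HA; have d0 : 0 <= 3 * (b - a) by lra.
have close y1 y2 : A y1 -> A y2 -> `|y2| - `|y1| <= 3 * (b - a).
  move=> /HA[x1 /andP[a1 b1]] /HA[x2 /andP[a2 b2]].
  have s1 := sqr_modulus (x +i* y1)%C; have s2 := sqr_modulus (x +i* y2)%C.
  move: s1 s2 a1 b1 a2 b2.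
  set m1 := modulus _; set m2 := modulus _ => /= s1 s2 a1 b1 a2 b2.
  have m10 : 0 <= m1 by exact: modulus_ge0.
  have m20 : 0 <= m2 by exact: modulus_ge0.
  rewrite -(real_normK (num_real x)) -(real_normK (num_real y1)) in s1.
  rewrite -(real_normK (num_real x)) -(real_normK (num_real y2)) in s2.
  move: s1 s2 x1 x2 (normr_ge0 x) (normr_ge0 y1) (normr_ge0 y2).
  move: `|x| `|y1| `|y2| => X Y1 Y2 s1 s2 x1 x2 X0 Y10 Y20.
  have Y2m : Y2 <= m2.
    by rewrite -(ler_pXn2r (ltn0Sn 1)) ?nnegrE // s2 lerDr sqr_ge0.
  have mY1 : m1 <= 2 * Y1.
    rewrite -(ler_pXn2r (ltn0Sn 1)) ?nnegrE ?mulr_ge0 // s1 exprMn.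
    have : X ^+ 2 <= Y1 ^+ 2 by rewrite ler_pXn2r ?nnegrE.
    have := sqr_ge0 Y1; lra.
  have mY2 : m2 <= 2 * Y2.
    rewrite -(ler_pXn2r (ltn0Sn 1)) ?nnegrE ?mulr_ge0 // s2 exprMn.
    have : X ^+ 2 <= Y2 ^+ 2 by rewrite ler_pXn2r ?nnegrE.
    have := sqr_ge0 Y2; lra.
  have [le|lt] := leP (Y2 - Y1) 0; first by lra.
  (* (Y2 - Y1)(Y2 + Y1) = (m2 - m1)(m2 + m1) and m1 + m2 <= 2 (Y1 + Y2) *)
  have e : (Y2 - Y1) * (Y2 + Y1) = (m2 - m1) * (m2 + m1) by lra.
  have m12 : m1 <= m2.
    rewrite leNgt; apply/negP => m21.
    have : 0 <= (Y2 - Y1) * (Y2 + Y1) by apply: mulr_ge0; lra.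
    rewrite e nmulr_rge0 ?subr_lt0 // => h; lra.
  have : (Y2 - Y1) * (Y2 + Y1) <= (2 * (m2 - m1)) * (Y2 + Y1).
    have : (m2 - m1) * (m2 + m1) <= (m2 - m1) * (2 * (Y2 + Y1)) by apply: ler_wpM2l; lra.
    by rewrite e; lra.
  rewrite ler_pM2r; lra.
have [->|/set0P[y0 Ay0]] := eqVneq A set0; first by rewrite measure0 lee_fin; lra.
pose I c : set (measurableTypeR R) := `[c - 3 * (b - a), c + 3 * (b - a)]%classic.
have mI c : measurable (A `&` I c).
  by apply: measurableI => //; exact: measurable_itv.
have -> : A = (A `&` I `|y0|) `|` (A `&` I (- `|y0|)).
  rewrite -setIUr; apply/esym/setIidPl => y Ay.
  have h1 := close _ _ Ay0 Ay; have h2 := close _ _ Ay Ay0.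
  have [y_ge0|y_lt0] := leP 0 y.
    by left; rewrite /I /= in_itv /=; rewrite (ger0_norm y_ge0) in h1 h2; lra.
  by right; rewrite /I /= in_itv /=; rewrite (ltr0_norm y_lt0) in h1 h2; lra.
apply: (le_trans (measureU2 _ _ _)) => //.
rewrite (_ : (12 * (b - a))%:E = ((2 * (3 * (b - a)))%:E + (2 * (3 * (b - a)))%:E)%E).
  by apply: leeD; apply: lebesgue_diameter => //; apply: subIsetr.
by rewrite -EFinD; congr EFin; ring.
Qed.

(** The section bound integrated over [[-1, 1]], of length 2. *)
Lemma sector_bound (a b : R) (A : set (plane R)) : measurable A -> a < b ->
  (forall x y, A (x, y) -> [/\ `|x| <= 1, `|x| <= `|y| & a < modulus (x +i* y)%C <= b]) ->
  ((leb \x leb) A <= (24 * (b - a))%:E)%E.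
Proof.
move=> mA ab HA; rewrite /product_measure1.
have mx x : measurable (xsection A x) by exact: measurable_xsection.
pose B : set (measurableTypeR R) := `[(-1)%R, 1%R]%classic.
have mB : measurable B by exact: measurable_itv.
have d0 : 0 <= 12 * (b - a) by lra.
apply: (@le_trans _ _ (\int[leb]_x ((12 * (b - a))%:E * (\1_B x)%:E))%E).
  apply: ge0_le_integral => //.
  - exact: measurable_fun_xsection.
  - by apply: emeasurable_funM => //; apply/measurable_EFinP.
  - move=> x _ /=; have [xB|xB] := boolP (x \in B).
      rewrite indicE xB mule1; apply: (section_bound x) => // y /=.
      by rewrite /xsection /= inE => /HA[].
    rewrite indicE (negbTE xB) mule0 (_ : xsection A x = set0) ?measure0 //.
    apply/seteqP; split=> // y; rewrite /xsection /= inE => /HA[x1 _ _].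
    move: xB; rewrite notin_setE /B /= in_itv /=; rewrite ler_norml in x1.
    by move=> /negP; rewrite x1.
rewrite ge0_integralZl_EFin //; last by apply/measurable_EFinP.
have -> : (\int[leb]_x (\1_B x)%:E = 2%:E)%E.
  rewrite integral_indic // setIT; transitivity (leb B) => //.
  rewrite /B lebesgue_measure_itv /= lte_fin ifT; last by lra.
  by rewrite -EFinD; congr EFin; ring.
by rewrite -EFinM lee_fin; lra.
Qed.

(** The diagonals cut the set into a piece with steep points and its complement, which the exchange
    of coordinates makes steep. Only linearity in [b - a] matters, not the constant. *)
Lemma area_annulus (a b : R) (A : set (plane R)) : measurable A -> a < b ->
  (forall p, A p -> modulus (cplx p) < 1 /\ a < modulus (cplx p) <= b) ->
  (area A <= (48 * (b - a))%:E)%E.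
Proof.
move=> mA ab HA.
pose S : set (plane R) := [set p | p.1 ^+ 2 <= p.2 ^+ 2].
have mS : measurable S.
  rewrite (_ : S = setT `&` (fun p : plane R => p.2 ^+ 2 - p.1 ^+ 2) @^-1` `[0, +oo[).
    have mf : measurable_fun setT (fun p : plane R => p.2 ^+ 2 - p.1 ^+ 2).
      by apply: measurable_funB; apply: measurable_funX.
    by apply: mf => //; exact: measurable_itv.
  by rewrite setTI; apply/seteqP; split => p /=; rewrite in_itv /= subr_ge0 andbT.
have sqle (u v : R) : (`|u| <= `|v|) = (u ^+ 2 <= v ^+ 2).
  by rewrite -(ler_pXn2r (ltn0Sn 1)) ?nnegrE // !real_normK ?num_real.
have le1 (p : plane R) : A p -> `|p.1| <= 1 /\ `|p.2| <= 1.
  move=> /HA[p1 _]; split; apply: ltW; apply: le_lt_trans p1.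
    exact: (normr_Re_le (cplx p)).
  exact: (normr_Im_le (cplx p)).
have mAS : measurable (A `&` S) by exact: measurableI.
have mAC : measurable (A `\` S) by exact: measurableD.
rewrite -(setUIDK A S); apply: (le_trans (measureU2 (leb \x leb)%E _ _)) => //.
rewrite (_ : (48 * (b - a))%:E = ((24 * (b - a))%:E + (24 * (b - a))%:E)%E); last first.
  by rewrite -EFinD; congr EFin; ring.
apply: leeD.
  apply: sector_bound => // x y [Axy Sxy]; split; first by case: (le1 _ Axy).
    by rewrite sqle.
  by have [] := HA _ Axy.
(* Both orders of integration give the same measure, so the second piece may be sliced along the
   other axis. *)
have E : (leb \x leb)%E (A `\` S) = (leb \x^ leb)%E (A `\` S).
  by apply: product_measure_unique => // X Y mX mY; exact: product_measure2E.
apply: (@le_trans _ _ ((leb \x^ leb)%E (A `\` S))); first by rewrite -E.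
rewrite /product_measure2.
pose sw (p : plane R) : plane R := (p.2, p.1).
have msw : measurable_fun setT sw.
  by apply/measurable_fun_pairP; split; [exact: measurable_snd|exact: measurable_fst].
have mT : measurable (sw @^-1` (A `\` S)).
  by rewrite -[X in measurable X]setTI; apply: msw.
have := sector_bound a b _ mT ab; rewrite /product_measure1.
rewrite (_ : xsection (sw @^-1` (A `\` S)) = ysection (A `\` S)) //.
apply => x y [Axy Sxy]; split; first by case: (le1 _ Axy).
  by rewrite sqle; apply: ltW; rewrite ltNge; apply/negP.
have [_] := HA _ Axy.
by rewrite (_ : modulus (x +i* y)%C = modulus (y +i* x)%C) // /modulus /= addrC.
Qed.

End Area.

(** * Radii of an admissible weight *)

Section Weight.
Context {R : realType} (w : R -> R).
Hypothesis aw : admissible_weight w.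
Local Notation leb := (@lebesgue_measure R).

Lemma weight_gt0 x : 0 <= x < 1 -> 0 < w x.
Proof. by case: aw => _ + _ _; exact. Qed.

Lemma measurable_weight : measurable_fun (`[0, 1[%classic : set (measurableTypeR R)) w.
Proof. by case: aw => cw _ _ _; exact: subspace_continuous_measurable_fun. Qed.

Definition tail (x : R) : \bar R := (\int[leb]_(t in `[x, 1%R[) (w t)%:E)%E.

Lemma subset_tail (x : R) : 0 <= x -> `[x, 1[%classic `<=` `[0, 1[%classic.
Proof.
move=> x0 t /=; rewrite !in_itv /= => /andP[xt ->].
by rewrite (le_trans x0 xt).
Qed.

Lemma measurable_weight_tail (x : R) : 0 <= x ->
  measurable_fun (`[x, 1[%classic : set (measurableTypeR R)) (EFin \o w).
Proof.
move=> x0; apply/measurable_EFinP; apply: measurable_funS measurable_weight => //.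
exact: subset_tail.
Qed.

Lemma weight_tail_ge0 (x t : R) : 0 <= x -> `[x, 1[%classic t -> (0 <= (w t)%:E)%E.
Proof.
move=> x0 /(subset_tail _ x0) /=; rewrite in_itv /= => t1.
by rewrite lee_fin; apply: ltW; exact: weight_gt0.
Qed.

Lemma tail_le (x y : R) : 0 <= x -> x <= y -> (tail y <= tail x)%E.
Proof.
move=> x0 xy; apply: ge0_subset_integral => //; first exact: measurable_weight_tail.
  by move=> t; exact: weight_tail_ge0.
by move=> t /=; rewrite !in_itv /= => /andP[/(le_trans xy) -> ->].
Qed.

(** The pointwise condition is integrated along [x |-> (1 + x) / 2], which maps [[1 - 2 t, 1[] onto
    [[1 - t, 1[]; the factor 2 is its Jacobian. *)
Lemma tail_doubling : exists2 c : R, 0 < c &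
  forall t, 0 < t <= 1 / 2 -> (c%:E * tail (1 - 2 * t) <= 2%:E * tail (1 - t))%E.
Proof.
have [_ _ _ [c c0 Hc]] := aw; exists c => // t t12.
have [t0 t2] := andP t12.
have x0 : 0 <= 1 - 2 * t by lra.
have y0 : 0 <= 1 - t by lra.
pose g (x : measurableTypeR R) : measurableTypeR R := (1 + x) / 2.
have mg : measurable_fun setT g.
  by apply: measurable_funM => //; apply: measurable_funD.
have gE : g @^-1` `[1 - t, 1[%classic = `[1 - 2 * t, 1[%classic.
  by apply/seteqP; split=> x; rewrite /g /= !in_itv /= => /andP[h1 h2]; apply/andP; split; lra.
have mD : measurable (`[1 - t, 1[%classic : set (measurableTypeR R)) by exact: measurable_itv.
have H : (\int[leb]_(x in `[(1 - 2 * t)%R, 1%R[) (EFin \o w) (g x) <= 2%:E * tail (1 - t))%E.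
  rewrite -gE; apply: ge0_integral_comp_le => //.
  - move=> a b ab; rewrite (_ : _ @^-1` _ = `]2 * a - 1, 2 * b - 1]%classic).
      rewrite (_ : (2 * (b - a))%:E = leb `]2 * a - 1, 2 * b - 1]%classic) //.
      rewrite lebesgue_measure_itv /= lte_fin ifT; last by lra.
      by rewrite -EFinD; congr EFin; ring.
    by apply/seteqP; split=> x; rewrite /g /= !in_itv /= => /andP[h1 h2]; apply/andP; split; lra.
  - exact: (measurable_weight_tail _ y0).
  - by move=> x; exact: (weight_tail_ge0 _ _ y0).
apply: (le_trans _ H).
rewrite /tail -ge0_integralZl_EFin //; last 3 first.
  + by move=> x; exact: (weight_tail_ge0 _ _ x0).
  + exact: (measurable_weight_tail _ x0).
  + exact: ltW.
  have mwg : measurable_fun `[1 - 2 * t, 1[%classic (EFin \o w \o g).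
    apply: (measurable_comp mD _ (measurable_weight_tail _ y0)).
      by move=> _ [x xt <-]; have : (g @^-1` `[1 - t, 1[%classic) x by rewrite gE.
    exact: measurable_funS mg.
  apply: ge0_le_integral => //.
+ by move=> x xt; rewrite -EFinM lee_fin mulr_ge0 ?(ltW c0) // -lee_fin (weight_tail_ge0 _ _ x0).
+ by apply: emeasurable_funM => //; exact: (measurable_weight_tail _ x0).
+ move=> x; rewrite /= in_itv /= => /andP[x1 x2]; rewrite lee_fin /g.
    (* For the parameter [(1 - x) / 2] the two points of the condition are [x] and [(1 + x) / 2]. *)
    have := Hc ((1 - x) / 2) ltac:(apply/andP; split; lra).
    have e1 : 1 - 2 * ((1 - x) / 2) = x by field.
    have e2 : 1 - (1 - x) / 2 = (1 + x) / 2 by field.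
    by rewrite e1 e2.
Qed.

Context (r : nat -> R).
Hypothesis wr : weight_radii w r.

Lemma radius_ge0 n : 0 <= r n.
Proof. by have [/andP[]] := wr n. Qed.

Lemma radius_lt1 n : r n < 1.
Proof. by have [/andP[]] := wr n. Qed.

Lemma tail_radius n : tail (r n) = ((2 ^- n)%R : R)%:E.
Proof. by have [_] := wr n. Qed.

Lemma radius_lt n : r n < r n.+1.
Proof.
rewrite ltNge; apply/negP => /(tail_le _ _ (radius_ge0 n.+1)).
rewrite !tail_radius lee_fin half_powS; have := @half_pow_gt0 R n; lra.
Qed.

Lemma radius_le m n : (m <= n)%N -> r m <= r n.
Proof.
move=> /subnKC <-; elim: (n - m)%N => [|k IH]; first by rewrite addn0.
by rewrite addnS (le_trans IH) // ltW // radius_lt.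
Qed.

(** The weight has no mass on [[0, r 0[] and is positive there, so this interval is null. It follows
    that the annuli reach the centre and that [r 1] is positive. *)
Lemma radius0 : r 0%N = 0.
Proof.
apply/eqP; rewrite eq_le radius_ge0 andbT leNgt; apply/negP => r0.
have [cw _ w1 _] := aw.
have mA : measurable (`[0, r 0%N[%classic : set (measurableTypeR R)) by exact: measurable_itv.
have sA : `[0, r 0%N[%classic `<=` `[0, 1[%classic.
  move=> x /=; rewrite !in_itv /= => /andP[-> x1]; exact: lt_trans x1 (radius_lt1 0).
have E : `[0, 1[%classic = `[0, r 0%N[%classic `|` `[r 0%N, 1[%classic.
  by rewrite -(@itv_bndbnd_setU _ _ (BLeft 0) (BLeft (r 0%N)) (BLeft 1)) // bnd_simp ltW // radius_lt1.
have : (\int[leb]_(x in `[0%R, r 0%N[) (w x)%:E = 0)%E.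
  move: w1; rewrite E ge0_integral_setU //; last 3 first.
  - by rewrite -E; exact: measurable_weight_tail.
  - by rewrite -E => x; exact: weight_tail_ge0.
  - apply/disj_setPS => x [] /=; rewrite !in_itv /= => /andP[_ h1] /andP[h2 _].
    by move: (lt_le_trans h1 h2); rewrite ltxx.
  have := tail_radius 0; rewrite /tail expr0 invr1 => ->.
  have := @integral_ge0 _ _ _ leb `[0%R, r 0%N[%classic (EFin \o w).
  move=> /(_ (fun x xA => weight_tail_ge0 0 x (lexx 0) (sA x xA))).
  case: (\int[leb]_(x in `[0%R, r 0%N[) (EFin \o w) x)%E => // s _ [] /eqP.
  by rewrite -subr_eq0 addrK => /eqP ->.
have mw : measurable_fun (`[0, r 0%N[%classic : set (measurableTypeR R)) (EFin \o w).
  by apply: measurable_funS (measurable_weight_tail 0 (lexx 0)).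
move=> I0.
have : (\int[leb]_(x in `[0%R, r 0%N[) `|(EFin \o w) x| = 0)%E.
  rewrite -[RHS]I0; apply: eq_integral => x; rewrite inE => /sA xA.
  by rewrite gee0_abs // (weight_tail_ge0 0).
move/(ae_eq_integral_abs leb mA mw) => [N [mN N0 sN]].
have sAN : `[0, r 0%N[%classic `<=` N.
  move=> x xA; apply: sN => /= /(_ xA) [] wx.
  have := sA _ xA; rewrite /= in_itv /= => /weight_gt0.
  by rewrite wx ltxx.
have : (leb `[0%R, r 0%N[%classic <= leb N)%E by apply: le_measure => //; rewrite inE.
by rewrite N0 lebesgue_measure_itv /= lte_fin r0 -EFinD subr0 lee_fin leNgt r0.
Qed.

(** With [t = (1 - r n) / 2], doubling compares the tails at [r n] and at [1 - t]. Were
    [r (n + k.+1)] below [1 - t], it would give [c 2^-n <= 2 * 2^-(n + k + 1)], that is [c <= 2^-k],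
    against [2^-k < c / 2]. *)
Lemma radius_contract : exists2 k : nat, (0 < k)%N &
  forall n, 1 - r (n + k)%N <= (1 - r n) / 2.
Proof.
have [c c0 Hc] := tail_doubling.
have [k hk] := half_pow_lt (c / 2) (divr_gt0 c0 (ltr0Sn R 1)).
exists k.+1 => // n; rewrite leNgt; apply/negP => lt.
pose t := (1 - r n) / 2.
have r0 := radius_ge0 n; have r1 := radius_lt1 n.
have := Hc t ltac:(rewrite /t; apply/andP; split; lra).
rewrite (_ : 1 - 2 * t = r n); last by rewrite /t; field.
rewrite tail_radius => /le_trans => /(_ (2%:E * tail (r (n + k.+1)%N))%E).
have r2 := radius_ge0 (n + k.+1).
have tl : (2%:E * tail (1 - t) <= 2%:E * tail (r (n + k.+1)%N))%E.
  by apply: lee_wpmul2l => //; apply: tail_le => //; rewrite /t; lra.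
move=> /(_ tl); rewrite tail_radius -!EFinM lee_fin exprD invfM half_powS.
have := @half_pow_gt0 R n; move: hk; have := @half_pow_gt0 R k.
move: (2 ^- n : R) (2 ^- k : R) => u v v0 vc u0.
rewrite mulrCA mulrC ler_pM2l //; lra.
Qed.

(** The image of area on the disk under the modulus is at most 48 times Lebesgue measure, and [w]
    has integral 1. This puts the polynomials in the Bergman space. *)
Lemma weight_disk_finite :
  (disk_integral (@area R) (fun z => (w (modulus z))%:E) < +oo)%E.
Proof.
have mD : measurable (`[0, 1[%classic : set (measurableTypeR R)) by exact: measurable_itv.
have mw0 := measurable_weight_tail 0 (lexx 0).
pose ar := mrestr (leb \x leb)%E (@measurable_disk R).
pose m (p : plane R) : measurableTypeR R := modulus (cplx p).
have mm : measurable_fun setT m := measurable_modulus.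
have -> : disk_integral (@area R) (fun z => (w (modulus z))%:E) =
    (\int[ar]_(p in m @^-1` `[0%R, 1%R[) (EFin \o w) (m p))%E.
  rewrite /disk_integral preimage_disk; apply: eq_measure_integral => A mA AD.
  by rewrite /ar /= /mrestr setIidl // preimage_disk.
apply: (@le_lt_trans _ _ (48%:E * tail 0)%E); last first.
  by have [_ _ w1 _] := aw; rewrite /tail w1 mule1 ltry.
apply: ge0_integral_comp_le => //; last by move=> x; exact: weight_tail_ge0.
move=> a b ab; rewrite /ar /= /mrestr; apply: area_annulus => //.
  apply: measurableI; last exact: measurable_disk.
  by rewrite -[X in measurable X]setTI; apply: mm => //; exact: measurable_itv.
by move=> p [/=]; rewrite in_itv.
Qed.

End Weight.

(** * Polynomials and analytic functions *)

Section FatouBound.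
Local Open Scope ereal_scope.
Context {d} {T : measurableType d} {R : realType} (mu : {measure set T -> \bar R}).

(** Fatou's lemma in the form that carries a uniform upper bound from polynomials to their pointwise
    limit. *)
Lemma fatou_bound (D : set T) (g_ : nat -> T -> R) (g : T -> R) (K : \bar R) :
  measurable D -> (forall n, measurable_fun D (g_ n)) ->
  (forall n x, D x -> (0 <= g_ n x)%R) ->
  (forall x, D x -> (fun n => g_ n x) @ \oo --> g x) ->
  (forall n, \int[mu]_(x in D) (g_ n x)%:E <= K) ->
  \int[mu]_(x in D) (g x)%:E <= K.
Proof.
move=> mD mg g0 gg gK.
have -> : \int[mu]_(x in D) (g x)%:E = \int[mu]_(x in D) limn_einf (fun n => (g_ n x)%:E).
  apply: eq_integral => x; rewrite inE => Dx.
  have cg : (fun n => (g_ n x)%:E) @ \oo --> (g x)%:E.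
    by apply: cvg_EFin; [exact: nearW|exact: gg].
  rewrite is_cvg_limn_einfE; last by apply/cvg_ex; exists (g x)%:E.
  by apply/esym/cvg_lim.
apply: (@le_trans _ _ (limn_einf (fun n => \int[mu]_(x in D) (g_ n x)%:E))).
  apply: (fatou mu mD (f := fun n x => (g_ n x)%:E)).
    by move=> n; apply/measurable_EFinP.
  by move=> n x Dx; rewrite lee_fin g0.
rewrite limn_einf_lim; apply: lime_le; first exact: is_cvg_einfs.
apply: nearW => n; apply: le_trans (gK n).
by apply: ereal_inf_lbound; exists n => /=.
Qed.

End FatouBound.

Section Polynomials.
Context {R : realType}.
Implicit Types (b : nat -> R[i]) (z : R[i]).

Definition cmeas (u : plane R -> R[i]) :=
  measurable_fun setT (fun p => complex.Re (u p)) /\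
  measurable_fun setT (fun p => complex.Im (u p)).

Lemma cmeasD u v : cmeas u -> cmeas v -> cmeas (fun p => u p + v p).
Proof.
move=> [u1 u2] [v1 v2]; split.
  by under eq_fun do rewrite complex_ReD; apply: measurable_funD.
by under eq_fun do rewrite complex_ImD; apply: measurable_funD.
Qed.

Lemma cmeasM u v : cmeas u -> cmeas v -> cmeas (fun p => u p * v p).
Proof.
move=> [u1 u2] [v1 v2]; split.
  by under eq_fun do rewrite complex_ReM; apply: measurable_funB; apply: measurable_funM.
by under eq_fun do rewrite complex_ImM; apply: measurable_funD; apply: measurable_funM.
Qed.

Lemma cmeas_cst (k : R[i]) : cmeas (fun=> k).
Proof. by split; exact: measurable_cst. Qed.

Lemma cmeas_pol b N : cmeas (fun p => pol b N (cplx p)).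
Proof.
have cX n : cmeas (fun p : plane R => cplx p ^+ n).
  elim: n => [|n IH]; first by under eq_fun do rewrite expr0; exact: cmeas_cst.
  under eq_fun do rewrite exprS; apply: cmeasM => //.
  by split; [exact: measurable_fst|exact: measurable_snd].
elim: N => [|N IH]; first by under eq_fun do rewrite /pol big_ord0; exact: cmeas_cst.
under eq_fun do rewrite /pol big_ord_recr.
by apply: cmeasD => //; apply: cmeasM => //; exact: cmeas_cst.
Qed.

Lemma measurable_modulus_pol b N : measurable_fun setT (fun p : plane R => modulus (pol b N (cplx p))).
Proof.
have [m1 m2] := cmeas_pol b N.
rewrite (_ : (fun p => _) = (@Num.sqrt R) \o (fun p : plane R =>
    complex.Re (pol b N (cplx p)) ^+ 2 + complex.Im (pol b N (cplx p)) ^+ 2)).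
  apply: measurableT_comp.
    by apply: continuous_measurable_fun; exact: sqrt_continuous.
  by apply: measurable_funD; apply: measurable_funX.
by apply/funext => p /=; rewrite -sqr_modulus sqrtr_sqr ger0_norm // modulus_ge0.
Qed.

Lemma measurable_sqmodulus_pol b N (D : set (plane R)) :
  measurable_fun D (fun p => modulus (pol b N (cplx p)) ^+ 2).
Proof.
by apply: measurable_funX; apply: measurable_funTS; exact: measurable_modulus_pol.
Qed.

Lemma derivable_expc N z :
  @derivable R[i] (R[i])^o (R[i])^o (fun u => u ^+ N) z (1 : R[i]).
Proof.
elim: N => [|N IH].
  rewrite (_ : (fun u => _) = cst (1 : R[i])); last by apply/funext => u; rewrite expr0.
  exact: derivable_cst.
have -> : (fun u : R[i] => u ^+ N.+1) = (fun u : R[i] => u * u ^+ N).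
  by apply/funext => u; rewrite exprS.
have := @derivableM R[i] (R[i])^o id (fun u : R[i] => u ^+ N) z 1.
apply.
  by have := @derivable_id R[i] (R[i])^o z 1.
exact: IH.
Qed.

Lemma derivable_pol b N z :
  @derivable R[i] (R[i])^o (R[i])^o (pol b N) z (1 : R[i]).
Proof.
elim: N => [|N IH].
  rewrite (_ : pol b 0 = cst (0 : R[i])); first exact: derivable_cst.
  by apply/funext => u; rewrite /pol big_ord0.
have -> : pol b N.+1 = (fun u : R[i] => pol b N u + b N * u ^+ N).
  by apply/funext => u; rewrite /pol big_ord_recr.
have := @derivableD R[i] (R[i])^o (R[i])^o (pol b N) (fun u : R[i] => b N * u ^+ N) z 1.
apply; first exact: IH.
have := @derivableM R[i] (R[i])^o (cst (b N)) (fun u : R[i] => u ^+ N) z 1.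
apply; last exact: derivable_expc.
by have := @derivable_cst R[i] (R[i])^o (R[i])^o (b N) z 1.
Qed.

Lemma analytic_pol b N : analytic_disk (pol b N).
Proof. by move=> z _; exact: derivable_pol. Qed.

Lemma modulus_pol_le b N z : modulus z <= 1 ->
  modulus (pol b N z) <= \sum_(m < N) modulus (b m).
Proof.
move=> z1; apply: (le_trans (modulus_sum _ _ _)); apply: ler_sum => m _.
rewrite modulusM modulusX ler_piMr ?modulus_ge0 // exprn_ile1 //; exact: modulus_ge0.
Qed.

Lemma hardy_sqnorm_pol b N :
  (hardy_sqnorm (pol b N) <= (\sum_(m < N) modulus (b m) ^+ 2)%:E)%E.
Proof.
apply: ge_ereal_sup => _ [rho /andP[r0 r1] <-].
rewrite circle_mean_pol // lee_fin; apply: ler_sum => m _.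
by rewrite ler_piMr ?sqr_ge0 // exprn_ile1 // ltW.
Qed.

Lemma hardy_pol b N : hardy (pol b N).
Proof.
split; first exact: analytic_pol.
by apply: (le_lt_trans (hardy_sqnorm_pol _ _)); rewrite ltry.
Qed.

Lemma measurable_weight_disk (w : R -> R) : admissible_weight w ->
  measurable_fun (@cplx R @^-1` @unit_disk R) (fun p => w (modulus (cplx p))).
Proof.
move=> aw; have mD : measurable (`[0, 1[%classic : set (measurableTypeR R)) by exact: measurable_itv.
apply: (@measurable_comp _ _ _ _ _ _ (`[0, 1[%classic : set (measurableTypeR R)) w _
  (fun p : plane R => modulus (cplx p) : measurableTypeR R)) => //.
- by move=> _ [p pD <-]; move: pD; rewrite preimage_disk.
- exact: measurable_weight.
- by apply: measurable_funTS; exact: measurable_modulus.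
Qed.

Lemma bergman_pol (w : R -> R) b N : admissible_weight w -> bergman w (pol b N).
Proof.
move=> aw; split; first exact: analytic_pol.
set B := \sum_(m < N) modulus (b m).
have mw := measurable_weight_disk w aw.
have mw' : measurable_fun (@cplx R @^-1` @unit_disk R) (fun p => (w (modulus (cplx p)))%:E).
  by apply/measurable_EFinP.
have w0 p : (@cplx R @^-1` @unit_disk R) p -> 0 <= w (modulus (cplx p)).
  by rewrite preimage_disk /= in_itv /= => H; apply: ltW; exact: (weight_gt0 w).
apply: (@le_lt_trans _ _ ((B ^+ 2)%:E * disk_integral (@area R) (fun z => (w (modulus z))%:E))%E).
  have mD := @measurable_disk R.
  have w0' p : (@cplx R @^-1` @unit_disk R) p -> (0 <= (w (modulus (cplx p)))%:E)%E.
    by move=> pD; rewrite lee_fin w0.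
  rewrite /disk_integral -(@ge0_integralZl_EFin _ _ _ _ _ mD _ w0' mw' _ (sqr_ge0 B)).
  apply: ge0_le_integral => //.
  - by move=> p pD; rewrite lee_fin mulr_ge0 ?sqr_ge0 ?w0.
  - by apply/measurable_EFinP; apply: measurable_funM => //; exact: measurable_sqmodulus_pol.
  - by apply/measurable_EFinP; apply: measurable_funM.
  - move=> p pD; rewrite -EFinM lee_fin; apply: ler_wpM2r; first exact: w0.
    have pB : modulus (pol b N (cplx p)) <= B by apply: modulus_pol_le; exact: ltW.
    by apply: lerXn2r => //; rewrite nnegrE ?(le_trans _ pB) ?modulus_ge0.
have I_lt := weight_disk_finite w aw.
have I0 : (0 <= disk_integral (@area R) (fun z => (w (modulus z))%:E))%E.
  by apply: integral_ge0 => p pD; rewrite lee_fin w0.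
move: I_lt I0; move: (disk_integral _ _) => [v| |] // _ _.
by rewrite -EFinM ltry.
Qed.

End Polynomials.

(** * Analytic functions as limits of polynomials *)

Section AnalyticFunctions.
Context {R : realType}.

(** The expansion in the variable of [f] itself: dividing the coefficients by powers of [rho] turns
    their square sum into the squared norm of H^2 on the disk of radius [rho]. *)
Lemma rescaled_expansion (f : R[i] -> R[i]) rho : analytic_disk f -> 0 < rho < 1 ->
  exists a : nat -> R[i],
    (forall N, (\sum_(m < N) modulus (a m) ^+ 2 * rho ^+ (2 * m))%:E <= circle_mean f rho)%E /\
    forall z, modulus z < rho -> modulus (pol a N z) @[N --> \oo] --> modulus (f z).
Proof.
move=> af r01; have [b [Hb Hc]] := power_expansion f rho af r01.
have [r0 r1] := andP r01.
have rC : rho%:C%C != 0 :> R[i] by rewrite eq_complex /= eqxx andbT gt_eqF.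
exists (fun m => b m / rho%:C%C ^+ m); split.
  move=> N; apply: le_trans (Hb N); rewrite lee_fin; apply: ler_sum => m _.
  rewrite modulusM modulusV modulusX (modulus_realp (ltW r0)) exprMn exprVn -exprM.
  by rewrite [(_ * 2)%N]mulnC -mulrA mulVf ?mulr1 // expf_neq0 // gt_eqF.
move=> z zr; have := Hc (z / rho%:C%C).
rewrite modulusM modulusV (modulus_realp (ltW r0)) ltr_pdivrMr // mul1r => /(_ zr).
have -> : rho%:C%C * (z / rho%:C%C) = z by rewrite mulrC divfK.
rewrite (_ : (fun N => modulus (pol b N (z / rho%:C%C))) =
  (fun N => modulus (pol (fun m => b m / rho%:C%C ^+ m) N z))) //.
apply/funext => N; congr modulus; apply: eq_bigr => m _.
by rewrite exprMn exprVn mulrAC -mulrA.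
Qed.

Lemma measurable_ball (s : R) : measurable [set p : plane R | modulus (cplx p) < s].
Proof.
rewrite (_ : [set p | _] = setT `&` (fun p : plane R => modulus (cplx p)) @^-1` `]-oo, s[).
  by apply: measurable_modulus => //; exact: measurable_itv.
by rewrite setTI; apply/seteqP; split=> p /=; rewrite in_itv.
Qed.

Lemma measurable_analytic (f : R[i] -> R[i]) : analytic_disk f ->
  measurable_fun (@cplx R @^-1` @unit_disk R) (fun p => modulus (f (cplx p)) ^+ 2).
Proof.
move=> af; apply: measurable_funX.
(* The exponent [j.+1] keeps [rho 0] positive. These disks exhaust the unit disk, and on each of
   them [f] has an expansion of its own. *)
pose rho (j : nat) : R := 1 - 2 ^- j.+1.
have rho01 j : 0 < rho j < 1.
  rewrite /rho half_powS; have := @half_pow_gt0 R j.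
  have : 2 ^- j <= 1 :> R by rewrite invf_le1 ?exprn_gt0 // exprn_ege1 // ler1n.
  by move=> *; apply/andP; split; lra.
rewrite (_ : _ @^-1` _ = \bigcup_j [set p : plane R | modulus (cplx p) < rho j]).
  apply/measurable_fun_bigcup; first by move=> j; exact: measurable_ball.
  move=> j; have [a [_ Ha]] := rescaled_expansion f (rho j) af (rho01 j).
  apply: (measurable_fun_cvg (h := fun N (p : plane R) => modulus (pol a N (cplx p)))).
    by move=> N; apply: measurable_funTS; exact: measurable_modulus_pol.
  by move=> p; exact: Ha.
apply/seteqP; split=> [p|p [j _]] /=; rewrite /unit_disk /=.
  move=> p1; have [j hj] := half_pow_lt (1 - modulus (cplx p)) ltac:(by rewrite subr_gt0).
  exists j => //; apply: (@lt_le_trans _ _ (1 - 2 ^- j)).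
    by rewrite ltrBrDr addrC -ltrBrDr.
  by rewrite /rho half_powS; have := @half_pow_gt0 R j; lra.
by move=> /lt_trans; apply; case/andP: (rho01 j).
Qed.

Lemma disk_integral_annulus_part (mu : {measure set (plane R) -> \bar R}) (r : nat -> R) n
    (f : R[i] -> R[i]) : r n.+1 <= 1 -> analytic_disk f ->
  disk_integral (annulus_part mu r n) (fun z => (modulus (f z) ^+ 2)%:E) =
  (\int[mu]_(p in annulus r n) (modulus (f (cplx p)) ^+ 2)%:E)%E.
Proof.
move=> r1 af; rewrite /disk_integral integral_mrestr //.
- congr integral; apply/seteqP; split=> [p []//|p pr]; split => //.
  by case/andP: (pr) => _ /lt_le_trans; apply.
- exact: measurable_disk.
- by apply/measurable_EFinP; exact: measurable_analytic.
- by move=> p _; rewrite lee_fin sqr_ge0.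
Qed.

End AnalyticFunctions.

(** * Schur's argument and the choice of the exponent *)

Section Schur.
Context {R : realType}.

(** The Taylor coefficients of [(1 - x) / (1 - x / rho^2)]. *)
Definition schur_weight (rho : R) (j : nat) : R :=
  if j is 0 then 1 else (1 - rho ^+ 2) / rho ^+ (2 * j).

Lemma schur_weight_ge0 rho j : 0 < rho < 1 -> 0 <= schur_weight rho j.
Proof.
move=> /andP[r0 r1]; case: j => [|j] //=.
by rewrite divr_ge0 ?exprn_ge0 ?(ltW r0) // subr_ge0 exprn_ile1 // ltW.
Qed.

(** The sum telescopes. This is the kernel factorization read on coefficients, since multiplication
    by [1 / (1 - x)] forms partial sums. *)
Lemma sum_schur_weight rho m : rho != 0 ->
  \sum_(j < m.+1) schur_weight rho j = (rho ^+ (2 * m))^-1.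
Proof.
move=> r0; elim: m => [|m IH]; first by rewrite big_ord1 expr0 invr1.
have h : rho ^+ (2 * m) != 0 by rewrite expf_neq0.
by rewrite big_ord_recr IH /= mulnS exprD; field; rewrite h r0.
Qed.

(** Here [x] stands for [|z|]. The full series sums to [(1 - x^2) / (1 - x^2 / rho^2)], which is at
    most 2 by the two inequalities [1 - x <= 2 (rho - x)] and [rho^2 (1 + x) <= rho + x]. *)
Lemma sum_schur_weight_le rho x N : 0 < rho -> rho < 1 -> 0 <= x -> 1 - x <= 2 * (rho - x) ->
  x < rho -> \sum_(j < N) schur_weight rho j * x ^+ (2 * j) <= 2.
Proof.
move=> r0 r1 x0 hx xr; case: N => [|N]; first by rewrite big_ord0.
have rn0 : rho != 0 by rewrite gt_eqF.
pose q := x ^+ 2 / rho ^+ 2.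
have xq : x ^+ 2 = rho ^+ 2 * q by rewrite /q; field.
have q0 : 0 <= q by rewrite /q divr_ge0 ?sqr_ge0.
have q1 : q < 1.
  rewrite /q ltr_pdivrMr ?exprn_gt0 // mul1r ltr_pXn2r ?nnegrE //; exact: ltW.
have E M : (1 - q) * \sum_(j < M.+1) schur_weight rho j * x ^+ (2 * j) =
    1 - x ^+ 2 - (1 - rho ^+ 2) * q ^+ M.+1.
  elim: M => [|M IH]; first by rewrite big_ord1 /= !expr0 xq; ring.
  rewrite big_ord_recr /= mulrDr IH.
  have -> : (1 - rho ^+ 2) / rho ^+ (2 * M.+1) * x ^+ (2 * M.+1) = (1 - rho ^+ 2) * q ^+ M.+1.
    by rewrite /q exprMn exprVn -!exprM; ring.
  by rewrite (exprS q M.+1); ring.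
have qN : 0 <= (1 - rho ^+ 2) * q ^+ N.+1.
  by rewrite mulr_ge0 ?exprn_ge0 // subr_ge0 exprn_ile1 // ltW.
have q1' : 0 < 1 - q by rewrite subr_gt0.
rewrite -(ler_pM2l q1') E.
suff : 1 - x ^+ 2 <= (1 - q) * 2 by move: qN; lra.
rewrite -(ler_pM2l (exprn_gt0 2 r0)).
have -> : rho ^+ 2 * ((1 - q) * 2) = (2 * (rho - x)) * (rho + x).
  by rewrite mulrA mulrBr mulr1 -xq; ring.
have -> : rho ^+ 2 * (1 - x ^+ 2) = (1 - x) * (rho ^+ 2 * (1 + x)) by ring.
apply: ler_pM => //; first by lra.
  by rewrite mulr_ge0 ?sqr_ge0 //; lra.
have rr : rho ^+ 2 <= rho by rewrite expr2 ler_piMr // ltW.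
have : rho ^+ 2 * x <= 1 * x by rewrite ler_wpM2r //; lra.
lra.
Qed.

Lemma weighted_cauchy_schwarz n (l x y : nat -> R) : (forall j, 0 <= l j) ->
  (\sum_(j < n) l j * (x j * y j)) ^+ 2 <=
  (\sum_(j < n) l j * x j ^+ 2) * (\sum_(j < n) l j * y j ^+ 2).
Proof.
move=> l0; elim: n => [|n IH]; first by rewrite !big_ord0 expr0n mulr0.
rewrite !big_ord_recr /=.
have A0 : 0 <= \sum_(j < n) l j * x j ^+ 2.
  by apply: sumr_ge0 => j _; rewrite mulr_ge0 ?sqr_ge0.
have B0 : 0 <= \sum_(j < n) l j * y j ^+ 2.
  by apply: sumr_ge0 => j _; rewrite mulr_ge0 ?sqr_ge0.
move: IH A0 B0 (l0 n); move: (\sum_(j < n) l j * x j ^+ 2) (\sum_(j < n) l j * y j ^+ 2).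
move: (\sum_(j < n) _) (l n) (x n) (y n) => S L u v A B IH A0 B0 L0.
have C0 : 0 <= A * v ^+ 2 + B * u ^+ 2 by rewrite addr_ge0 // mulr_ge0 // sqr_ge0.
(* As [S^2 <= A B] by induction, this is the inequality of arithmetic and geometric means for
   [A v^2] and [B u^2]. *)
have H : `|2 * (S * (u * v))| <= A * v ^+ 2 + B * u ^+ 2.
  rewrite -(ler_pXn2r (ltn0Sn 1)) ?nnegrE // real_normK ?num_real //.
  have : S ^+ 2 * (u * v) ^+ 2 <= A * B * (u * v) ^+ 2 by rewrite ler_wpM2r // sqr_ge0.
  have := sqr_ge0 (A * v ^+ 2 - B * u ^+ 2); lra.
have H2 : L * (2 * (S * (u * v))) <= L * (A * v ^+ 2 + B * u ^+ 2).
  by rewrite ler_wpM2l // (le_trans (ler_norm _)).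
lra.
Qed.

Lemma sum_triangle (V : nmodType) (F : nat -> nat -> V) N :
  \sum_(j < N) \sum_(i < N - j) F j (i + j)%N = \sum_(m < N) \sum_(j < m.+1) F j m.
Proof.
elim: N => [|N IH]; first by rewrite !big_ord0.
rewrite [RHS]big_ord_recr /= -IH.
rewrite (eq_bigr (fun j : 'I_N.+1 => \sum_(i < N - j) F j (i + j)%N + F j N)); last first.
  move=> j _; rewrite subSn ?(leq_ord j) // big_ord_recr /= subnK //; exact: leq_ord.
by rewrite big_split /= big_ord_recr /= subnn big_ord0 addr0.
Qed.

(** Multiplied by [z^j], the polynomial with these coefficients is the part of degree at least [j]
    of the polynomial with coefficients [a m * rho^(2 m)]. *)
Definition schur_part (a : nat -> R[i]) (rho : R) j (i : nat) : R[i] :=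
  a (i + j)%N * (rho ^+ (2 * (i + j)))%:C%C.

Lemma schur_decomposition a rho N (z : R[i]) : rho != 0 ->
  pol a N z = \sum_(j < N) (schur_weight rho j)%:C%C *
    (z ^+ j * pol (schur_part a rho j) (N - j) z).
Proof.
move=> r0; pose F j m := (schur_weight rho j)%:C%C * (a m * (rho ^+ (2 * m))%:C%C * z ^+ m).
transitivity (\sum_(j < N) \sum_(i < N - j) F j (i + j)%N); last first.
  apply: eq_bigr => j _; rewrite /pol /schur_part mulr_sumr mulr_sumr.
  by apply: eq_bigr => i _; rewrite /F exprD; ring.
rewrite sum_triangle; apply: eq_bigr => m _; rewrite -mulr_suml -rmorph_sum sum_schur_weight //.
have h : rho ^+ (2 * m) != 0 by rewrite expf_neq0.
have uv : (rho ^+ (2 * m))^-1%:C%C * (rho ^+ (2 * m))%:C%C = 1 :> R[i].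
  by rewrite -rmorphM mulVf // rmorph1.
transitivity ((rho ^+ (2 * m))^-1%:C%C * (rho ^+ (2 * m))%:C%C * (a m * z ^+ m)).
  by rewrite uv mul1r.
by rewrite /=; ring.
Qed.

(** Cauchy-Schwarz on the decomposition, with the Schur weights; the factor carrying the powers of
    [|z|] is at most 2. *)
Lemma schur_pointwise a rho N (z : R[i]) : 0 < rho < 1 ->
  1 - modulus z <= 2 * (rho - modulus z) -> modulus z < rho ->
  modulus (pol a N z) ^+ 2 <=
  2 * \sum_(j < N) schur_weight rho j * modulus (pol (schur_part a rho j) (N - j) z) ^+ 2.
Proof.
move=> r01 hz zr; have [r0 r1] := andP r01; have z0 := modulus_ge0 z.
have l0 j := schur_weight_ge0 rho j r01.
pose y j := modulus (pol (schur_part a rho j) (N - j) z).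
apply: (@le_trans _ _ ((\sum_(j < N) schur_weight rho j * (modulus z ^+ j * y j)) ^+ 2)).
  rewrite ler_pXn2r ?nnegrE ?modulus_ge0 //.
    rewrite (schur_decomposition a rho) ?gt_eqF //.
    apply: (le_trans (modulus_sum _ _ _)); apply: ler_sum => j _.
    by rewrite !modulusM modulusX modulus_realp.
  by apply: sumr_ge0 => j _; rewrite !mulr_ge0 ?exprn_ge0 ?modulus_ge0.
apply: (le_trans (weighted_cauchy_schwarz N _ _ _ l0)); apply: ler_wpM2r.
  by apply: sumr_ge0 => j _; rewrite mulr_ge0 ?sqr_ge0.
under eq_bigr do rewrite -exprM mulnC.
exact: sum_schur_weight_le.
Qed.

End Schur.

(** * Decay of powers of the radii *)

Section Numerics.
Context {R : realType}.

Lemma bernoulli_le (d : R) N : 0 <= d <= 1 -> 1 - N%:R * d <= (1 - d) ^+ N.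
Proof.
move=> /andP[d0 d1]; elim: N => [|N IH]; first by rewrite mul0r subr0 expr0.
rewrite exprS -natr1; have : 0 <= N%:R * (d * d) by rewrite !mulr_ge0.
have : (1 - d) * (1 - N%:R * d) <= (1 - d) * (1 - d) ^+ N by rewrite ler_wpM2l // subr_ge0.
move: ((1 - d) ^+ N) (N%:R : R) => P n; lra.
Qed.

(** With [x = M (1 - s)], one has [s^M <= exp (- x)] and [(x / p)^p <= exp x]. *)
Lemma exp_decay (s : R) M p : 0 <= s <= 1 -> s ^+ M * (M%:R * (1 - s)) ^+ p <= p%:R ^+ p.
Proof.
move=> /andP[s0 s1]; case: p => [|p].
  by rewrite !expr0 mulr1 exprn_ile1.
set x : R := M%:R * (1 - s); have x0 : 0 <= x by rewrite mulr_ge0 // subr_ge0.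
have p0 : 0 < p.+1%:R :> R by rewrite ltr0n.
have sM : s ^+ M <= expR (- x).
  rewrite /x -mulrN expRM_natl; apply: lerXn2r; rewrite ?nnegrE ?expR_ge0 //.
  by have := expR_ge1Dx (- (1 - s)); lra.
have xp : (x / p.+1%:R) ^+ p.+1 <= expR x.
  have -> : expR x = expR (x / p.+1%:R) ^+ p.+1.
    by rewrite -expRM_natl; congr expR; field; rewrite gt_eqF.
  apply: lerXn2r; rewrite ?nnegrE ?expR_ge0 ?divr_ge0 //.
  by apply: le_trans (expR_ge1Dx _); rewrite lerDr.
have : s ^+ M * (x / p.+1%:R) ^+ p.+1 <= 1.
  have h1 : 0 <= s ^+ M by exact: exprn_ge0.
  have h2 : 0 <= (x / p.+1%:R) ^+ p.+1 by apply: exprn_ge0; rewrite divr_ge0.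
  apply: (le_trans (ler_pM h1 h2 sM xp)).
  by rewrite expRN mulVf // lt0r_neq0 // expR_gt0.
by rewrite expr_div_n mulrA ler_pdivrMr ?exprn_gt0 // mul1r.
Qed.

Lemma sum_half_pow_rev n : \sum_(0 <= i < n.+1) (2 ^- (n - i) : R) <= 2.
Proof.
have H m : \sum_(i < m) (2 ^- i : R) <= 2 - 2 * 2 ^- m.
  elim: m => [|m IH]; first by rewrite big_ord0 expr0 invr1 mulr1 subrr.
  by rewrite big_ord_recr /= half_powS; lra.
rewrite big_mkord (reindex_inj rev_ord_inj) /=.
rewrite (eq_bigr (fun i : 'I_n.+1 => 2 ^- i)); last first.
  by move=> i _; rewrite subSS subKn // leq_ord.
by apply: (le_trans (H _)); have := @half_pow_gt0 R n.+1; lra.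
Qed.

Lemma sum_half_pow_tail n L : \sum_(n.+1 <= i < n.+1 + L) (2 ^- i : R) <= 2 ^- n.
Proof.
have H : \sum_(n.+1 <= i < n.+1 + L) (2 ^- i : R) = 2 ^- n - 2 ^- (n + L).
  elim: L => [|L IH]; first by rewrite !addn0 big_geq // subrr.
  rewrite addnS big_nat_recr ?leq_addr //= IH.
  have -> : (2 ^- (n.+1 + L) : R) = 2 ^- (n + L) / 2 by rewrite addSn half_powS.
  have -> : (2 ^- (n + L.+1) : R) = 2 ^- (n + L) / 2 by rewrite addnS half_powS.
  by lra.
by rewrite H; have := @half_pow_gt0 R (n + L); lra.
Qed.

Section RadiusSum.
Context (r : nat -> R) (k : nat).
Hypothesis r_ge0 : forall n, 0 <= r n.
Hypothesis r_lt1 : forall n, r n < 1.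
Hypothesis r_le : forall m n, (m <= n)%N -> r m <= r n.
Hypothesis r1_gt0 : 0 < r 1%N.
Hypothesis k0 : (0 < k)%N.
Hypothesis contract : forall n, 1 - r (n + k)%N <= (1 - r n) / 2.

(** Every [k] steps halve the gap, so its [k]-th power loses a factor 2 per step on average;
    [2 ^+ k] absorbs an incomplete block of steps. *)
Lemma gap_decay i l : (1 - r (i + l)%N) ^+ k <= 2 ^+ k * 2 ^- l * (1 - r i) ^+ k.
Proof.
have d0 j : 0 <= 1 - r j by rewrite subr_ge0 ltW.
elim/ltn_ind: l => l IH; have [lk|kl] := ltnP l k.
  rewrite -[leLHS]mul1r; apply: ler_pM; rewrite ?exprn_ge0 //.
    rewrite ler_pdivlMr ?exprn_gt0 // mul1r ler_eXn2l ?ltr1n //; exact: ltnW.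
  apply: lerXn2r; rewrite ?nnegrE //.
  by have := r_le i (i + l) (leq_addr _ _); lra.
have ltl : (l - k < l)%N by rewrite ltn_subrL k0 (leq_trans k0 kl).
have H1 : (1 - r (i + l)%N) ^+ k <= ((1 - r (i + (l - k))%N) / 2) ^+ k.
  apply: lerXn2r; rewrite ?nnegrE ?divr_ge0 //.
  by have := contract (i + (l - k)); rewrite -addnA subnK.
apply: (le_trans H1); rewrite expr_div_n ler_pdivrMr ?exprn_gt0 //.
apply: (le_trans (IH _ ltl)).
rewrite -{2}(subnK kl) exprD invfM le_eqVlt; apply/orP; left; apply/eqP.
have h : 2 ^+ k != 0 :> R by rewrite expf_neq0 // pnatr_eq0.
have h' : 2 ^+ (l - k) != 0 :> R by rewrite expf_neq0 // pnatr_eq0.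
by field; rewrite h h'.
Qed.

(* N is chosen of size 1 / (2 (1 - r_n)), so that |z|^N is bounded below where
   |z| >= r_n, while r_i^N is tiny as soon as 1 - r_i is much larger than 1 - r_n. *)
Lemma weighted_power_sum : exists2 B : R, 0 < B & forall n, exists N,
  1 / 2 <= r n ^+ N /\
  forall M, \sum_(1 <= i < M) 2 ^- i * r i ^+ (2 * N) <= B * 2 ^- n.
Proof.
(* [(4 k)^(2 k)] combines [(2 k)^(2 k)] from [exp_decay] with the lower bound [1 / 2] for
   [N.+1 * (1 - r n)], and [4^k] is the squared constant of [gap_decay]. Truncation bounds [N.+1]
   from below, not [N]; the inverse of [r 1] pays for the extra factor. *)
pose D : R := (r 1%N)^-1 * ((4 * k%:R) ^+ (2 * k) * 4 ^+ k).
have D0 : 0 <= D by rewrite /D !mulr_ge0 ?invr_ge0 ?exprn_ge0 ?mulr_ge0 // ltW.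
(* [2 * D] accounts for the indices [i <= n], after a geometric sum, and [1] for [i > n], where the
   powers are only bounded by 1. *)
exists (2 * D + 1); first by lra.
move=> n; have dn0 : 0 < 1 - r n by rewrite subr_gt0.
pose N := Num.truncn (1 / (2 * (1 - r n))).
have /andP[N1 N2] : N%:R <= 1 / (2 * (1 - r n)) < N.+1%:R.
  by apply: truncn_itv; rewrite divr_ge0 // mulr_ge0 // ltW.
rewrite ler_pdivlMr ?mulr_gt0 // in N1; rewrite ltr_pdivrMr ?mulr_gt0 // in N2.
exists N; split.
  have := bernoulli_le (1 - r n) N ltac:(apply/andP; split; have := r_ge0 n; lra).
  by rewrite opprB subrKC; lra.
have r2N i : 0 <= r i ^+ (2 * N) <= 1.
  by rewrite exprn_ge0 // exprn_ile1 // ltW.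
(* The exponent [2 k] in the decay estimate yields [4^-(n - i)]. Against [2^-i = 2^-n 2^(n - i)]
   there remains a summable [2^-(n - i)]. *)
have term i : (0 < i <= n)%N -> 2 ^- i * r i ^+ (2 * N) <= D * 2 ^- n * 2 ^- (n - i).
  move=> /andP[i0 in_]; have ri := r_lt1 i; have ri0 := r_ge0 i.
  have r1i : r 1%N <= r i by exact: r_le.
  have rip : 0 < r i by exact: lt_le_trans r1i.
  have di0 : 0 < 1 - r i by rewrite subr_gt0.
  have s1 : r i ^+ (2 * N) <= r i ^+ N.
    by rewrite mul2n -addnn exprD ler_piMr ?exprn_ge0 // exprn_ile1 // ltW.
  have s2 : r i ^+ N <= (r 1%N)^-1 * r i ^+ N.+1.
    by rewrite -ler_pdivrMl ?invr_gt0 // invrK exprS ler_wpM2r ?exprn_ge0.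
  have s3 : r i ^+ N.+1 * (1 - r i) ^+ (2 * k) <= (4 * k%:R * (1 - r n)) ^+ (2 * k).
    have s01 : 0 <= r i <= 1 by rewrite ri0 ltW.
    have := exp_decay (r i) N.+1 (2 * k) s01.
    rewrite exprMn mulrCA => H; rewrite exprMn.
    have h : (1 / 2) ^+ (2 * k) <= (N.+1%:R * (1 - r n)) ^+ (2 * k).
      by apply: lerXn2r; rewrite ?nnegrE ?mulr_ge0 ?(ltW dn0) //; lra.
    have t0 : 0 <= r i ^+ N.+1 * (1 - r i) ^+ (2 * k).
      by rewrite mulr_ge0 ?exprn_ge0 // ltW.
    have H2 : (N.+1%:R * (1 - r n)) ^+ (2 * k) * (r i ^+ N.+1 * (1 - r i) ^+ (2 * k)) <=
        (2 * k)%:R ^+ (2 * k) * (1 - r n) ^+ (2 * k).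
      rewrite exprMn mulrAC; apply: ler_wpM2r; first by rewrite exprn_ge0 // ltW.
      exact: H.
    have := le_trans (ler_wpM2r t0 h) H2.
    rewrite mul1r exprVn ler_pdivrMl ?exprn_gt0 // => /le_trans; apply.
    have e : 2 ^+ (2 * k) * (2 * k)%:R ^+ (2 * k) = (4 * k%:R) ^+ (2 * k) :> R.
      by rewrite -exprMn natrM; congr (_ ^+ _); ring.
    by rewrite mulrA e.
  have s4 : (1 - r n) ^+ (2 * k) <= 4 ^+ k * 4 ^- (n - i) * (1 - r i) ^+ (2 * k).
    have H := gap_decay i (n - i); rewrite subnKC // in H.
    have := lerXn2r 2 _ _ H; rewrite !nnegrE ?mulr_ge0 ?invr_ge0 ?exprn_ge0 ?(ltW dn0) ?(ltW di0) //.
    move=> /(_ isT isT); rewrite !exprMn exprVn -!exprM [(k * 2)%N]mulnC [((n - i) * 2)%N]mulnC.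
    by rewrite !(exprM 2 2) (_ : 2 ^+ 2 = 4 :> R) //; ring.
  have s5 : r i ^+ N.+1 <= (4 * k%:R) ^+ (2 * k) * 4 ^+ k * 4 ^- (n - i).
    rewrite -(ler_pM2r (exprn_gt0 (2 * k) di0)); apply: (le_trans s3).
    rewrite exprMn -!mulrA; apply: ler_wpM2l; last by rewrite mulrA.
    by rewrite exprn_ge0 // mulr_ge0.
  have s6 : r i ^+ (2 * N) <= D * 4 ^- (n - i).
    apply: (le_trans s1); apply: (le_trans s2); rewrite /D -mulrA; apply: ler_wpM2l => //.
    by rewrite invr_ge0 ltW.
  have -> : D * 2 ^- n * 2 ^- (n - i) = 2 ^- i * (D * 4 ^- (n - i)).
    have -> : (4 : R) = 2 * 2 by ring.
    rewrite exprMn invfM -{1}(subnK in_) exprD invfM.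
    have h : 2 ^+ i != 0 :> R by rewrite expf_neq0 // pnatr_eq0.
    have h' : 2 ^+ (n - i) != 0 :> R by rewrite expf_neq0 // pnatr_eq0.
    by field; rewrite h h'.
  by rewrite ler_wpM2l // ltW // half_pow_gt0.
have t0 i : 0 <= 2 ^- i * r i ^+ (2 * N).
  by case/andP: (r2N i) => h _; rewrite mulr_ge0 // ltW // half_pow_gt0.
move=> M; apply: (@le_trans _ _ (\sum_(1 <= i < n.+1 + M) 2 ^- i * r i ^+ (2 * N))).
  have [M0|M1] := leqP M 1; first by rewrite big_geq // sumr_ge0.
  rewrite [leRHS](@big_cat_nat _ _ _ M) //=; [|exact: ltnW|exact: leq_addl].
  by rewrite lerDl sumr_ge0.
rewrite (@big_cat_nat _ _ _ n.+1) //=; last exact: leq_addr.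
rewrite mulrDl mul1r; apply: lerD; last first.
  apply: le_trans (sum_half_pow_tail n M); apply: ler_sum => i _.
  by case/andP: (r2N i) => _ h; rewrite ler_piMr // ltW // half_pow_gt0.
apply: (@le_trans _ _ (\sum_(1 <= i < n.+1) D * 2 ^- n * 2 ^- (n - i))).
  by rewrite !big_nat; apply: ler_sum => i; rewrite ltnS; exact: term.
rewrite -mulr_sumr; have c0 : 0 <= D * 2 ^- n by rewrite mulr_ge0 // ltW // half_pow_gt0.
have -> : 2 * D * 2 ^- n = D * 2 ^- n * 2 by ring.
apply: ler_wpM2l => //; apply: le_trans (sum_half_pow_rev n).
by rewrite [leRHS]big_nat_recl // big_add1 /= lerDr ltW // half_pow_gt0.
Qed.

End RadiusSum.
End Numerics.

(** * Carleson bounds *)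

Section CarlesonBounds.
Context {R : realType}.

Lemma carleson_boundW (H : set (R[i] -> R[i])) N mu (C C' : R) :
  (forall f, H f -> (0 <= N f)%E) -> C <= C' ->
  carleson_bound H N mu C -> carleson_bound H N mu C'.
Proof.
move=> N0 CC [C0 HC]; split; first exact: lt_le_trans CC.
move=> f Hf; apply: (le_trans (HC f Hf)); apply: lee_wpmul2r; first exact: N0.
by rewrite lee_fin.
Qed.

Lemma circle_mean_ge0 (f : R[i] -> R[i]) rho : (0 <= circle_mean f rho)%E.
Proof.
apply: integral_ge0 => t _; rewrite lee_fin; apply: divr_ge0; first exact: sqr_ge0.
by apply: mulr_ge0 => //; exact: pi_ge0.
Qed.

Lemma hardy_sqnorm_ge0 (f : R[i] -> R[i]) : (0 <= hardy_sqnorm f)%E.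
Proof.
apply: (le_trans (circle_mean_ge0 f 0)); apply: ereal_sup_ubound.
by exists 0 => //=; rewrite lexx ltr01.
Qed.

(** The strict inequality avoids showing that the infimum is attained; it is met below by doubling
    the constant. *)
Lemma carleson_constant_bound (H : set (R[i] -> R[i])) N mu (C : R) :
  (forall f, H f -> (0 <= N f)%E) -> carleson H N mu ->
  carleson_constant H N mu < C -> carleson_bound H N mu C.
Proof.
move=> N0 [c Hc] lt; have ne : [set C | carleson_bound H N mu C] !=set0 by exists c.
by have [c' Hc' /ltW c'C] := inf_lt ne lt; exact: carleson_boundW Hc'.
Qed.

Lemma carleson_constant_le (H : set (R[i] -> R[i])) N mu (C : R) :
  carleson_bound H N mu C -> carleson_constant H N mu <= C.
Proof.
move=> HC; apply: ge_inf => //; exists 0 => c [c0 _]; exact: ltW.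
Qed.

Lemma measurable_sqmodulus_pol_EFin b N (D : set (plane R)) :
  measurable_fun D (fun p => (modulus (pol b N (cplx p)) ^+ 2)%:E).
Proof. by apply/measurable_EFinP; exact: measurable_sqmodulus_pol. Qed.

Context (mu : {measure set (plane R) -> \bar R}) (r : nat -> R).
Hypothesis r_ge0 : forall n, 0 <= r n.
Hypothesis r_lt1 : forall n, r n < 1.

(** The H^2 bound is applied to each Schur part. After exchange of the sums, the weights with
    [j <= m] add up to [rho^(-2 m)], which turns [rho^(4 m)] into [rho^(2 m)]. *)
Lemma pol_annulus_bound n C rho a N :
  carleson_bound (@hardy R) (@hardy_sqnorm R) (annulus_part mu r n) C ->
  0 < rho < 1 -> 1 - rho <= (1 - r n.+1) / 2 ->
  (\int[mu]_(p in annulus r n) (modulus (pol a N (cplx p)) ^+ 2)%:E <=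
   (2 * C * \sum_(m < N) modulus (a m) ^+ 2 * rho ^+ (2 * m))%:E)%E.
Proof.
move=> [C0 HC] r01 hr; have [r0 r1] := andP r01.
have mA := measurable_annulus r n.
have l0 j := schur_weight_ge0 rho j r01.
pose G j := pol (schur_part a rho j) (N - j).
have GC j : (\int[mu]_(p in annulus r n) (modulus (G j (cplx p)) ^+ 2)%:E <=
    (C * \sum_(i < N - j) modulus (schur_part a rho j i) ^+ 2)%:E)%E.
  rewrite -disk_integral_annulus_part ?(ltW (r_lt1 _)) //; last exact: analytic_pol.
  apply: (le_trans (HC _ (hardy_pol _ _))); rewrite EFinM.
  by apply: lee_wpmul2l; [rewrite lee_fin ltW|exact: hardy_sqnorm_pol].
apply: (@le_trans _ _ (\int[mu]_(p in annulus r n)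
    (\sum_(j < N) (2 * schur_weight rho j)%:E * (modulus (G j (cplx p)) ^+ 2)%:E))%E).
  apply: ge0_le_integral => //.
  - by move=> p _; rewrite lee_fin sqr_ge0.
  - exact: measurable_sqmodulus_pol_EFin.
  - apply: emeasurable_sum => j; apply: emeasurable_funM => //.
    exact: measurable_sqmodulus_pol_EFin.
  - move=> p /andP[_ pr].
    have z0 := modulus_ge0 (cplx p); have rn1 := r_lt1 n.+1.
    (* On the annulus [1 - rho] is at most half of [1 - |z|], hence [rho - |z|] is at least the
       other half. *)
    have hz : 1 - modulus (cplx p) <= 2 * (rho - modulus (cplx p)) by lra.
    have zr : modulus (cplx p) < rho by lra.
    have := schur_pointwise a rho N (cplx p) r01 hz zr.
    rewrite -lee_fin => /le_trans; apply; rewrite mulr_sumr -sumEFin.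
    by apply: lee_sum => j _; rewrite -EFinM lee_fin mulrA.
rewrite ge0_integral_sum //; last 2 first.
- move=> j; apply: emeasurable_funM => //; exact: measurable_sqmodulus_pol_EFin.
- by move=> j p _; rewrite -EFinM lee_fin mulr_ge0 ?sqr_ge0 // mulr_ge0.
apply: (@le_trans _ _ (\sum_(j < N) ((2 * schur_weight rho j)%:E *
    (C * \sum_(i < N - j) modulus (schur_part a rho j i) ^+ 2)%:E))%E).
  apply: lee_sum => j _.
  have jw : 0 <= 2 * schur_weight rho j by rewrite mulr_ge0.
  rewrite (@ge0_integralZl_EFin _ _ _ mu _ mA (fun p => (modulus (G j (cplx p)) ^+ 2)%:E)) //.
  - by apply: lee_wpmul2l; [rewrite lee_fin|exact: GC].
  - by move=> p _; rewrite lee_fin sqr_ge0.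
  - exact: measurable_sqmodulus_pol_EFin.
under eq_bigr do rewrite -EFinM.
rewrite sumEFin lee_fin le_eqVlt; apply/orP; left; apply/eqP.
pose F j m := schur_weight rho j * (modulus (a m) ^+ 2 * rho ^+ (2 * m) ^+ 2).
transitivity (2 * C * \sum_(j < N) \sum_(i < N - j) F j (i + j)%N).
  rewrite mulr_sumr; apply: eq_bigr => j _.
  rewrite (_ : \sum_(i < N - j) F j (i + j)%N =
    schur_weight rho j * \sum_(i < N - j) modulus (schur_part a rho j i) ^+ 2); first by ring.
  rewrite mulr_sumr; apply: eq_bigr => i _.
  rewrite /F /schur_part modulusM modulus_realp ?exprn_ge0 ?(ltW r0) //.
  by rewrite exprMn.
congr (_ * _); rewrite sum_triangle; apply: eq_bigr => m _.
rewrite /F -mulr_suml sum_schur_weight ?gt_eqF //.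
have h : rho ^+ (2 * m) != 0 by rewrite expf_neq0 // gt_eqF.
by rewrite expr2; field.
Qed.

Lemma analytic_annulus_bound n C rho f : analytic_disk f ->
  carleson_bound (@hardy R) (@hardy_sqnorm R) (annulus_part mu r n) C ->
  0 < rho < 1 -> 1 - rho <= (1 - r n.+1) / 2 ->
  (\int[mu]_(p in annulus r n) (modulus (f (cplx p)) ^+ 2)%:E <=
   (2 * C)%:E * circle_mean f rho)%E.
Proof.
move=> af HC r01 hr; have [a [Ha Hc]] := rescaled_expansion f rho af r01.
apply: (fatou_bound mu (annulus r n) (fun N p => modulus (pol a N (cplx p)) ^+ 2)).
- exact: measurable_annulus.
- by move=> N; exact: measurable_sqmodulus_pol.
- by move=> N p _; exact: sqr_ge0.
- move=> p /andP[_ pr]; have rn1 := r_lt1 n.+1.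
  have zr : modulus (cplx p) < rho by lra.
  by have H := Hc _ zr; rewrite expr2; under eq_fun do rewrite expr2; apply: cvgM.
- move=> N; apply: (le_trans (pol_annulus_bound n C rho a N HC r01 hr)).
  rewrite EFinM; apply: lee_wpmul2l; last exact: Ha.
  by rewrite lee_fin mulr_ge0 // ltW //; case: HC.
Qed.

Definition shift_coef (K : nat) (b : nat -> R[i]) m : R[i] :=
  if (m < K)%N then 0 else b (m - K)%N.

Lemma pol_shift K b N z : pol (shift_coef K b) (K + N) z = z ^+ K * pol b N z.
Proof.
rewrite /pol big_split_ord /= big1 ?add0r => [|i _]; last first.
  by rewrite /shift_coef ltn_ord mul0r.
rewrite mulr_sumr; apply: eq_bigr => i _.
by rewrite /shift_coef ltnNge leq_addr /= addKn exprD mulrCA.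
Qed.

Lemma circle_mean_shift K b N (s : R) : 0 <= s -> s < 1 ->
  (circle_mean (pol (shift_coef K b) (K + N)) s <=
   (s ^+ (2 * K) * \sum_(m < N) modulus (b m) ^+ 2)%:E)%E.
Proof.
move=> s0 s1; rewrite circle_mean_pol // lee_fin big_split_ord /= big1 ?add0r => [|i _]; last first.
  by rewrite /shift_coef ltn_ord modulus0 expr0n mul0r.
rewrite mulr_sumr; apply: ler_sum => i _.
rewrite /shift_coef ltnNge leq_addr /= addKn mulnDr exprD mulrCA -[leRHS]mulr1 -mulrA.
rewrite ler_wpM2l ?exprn_ge0 // ler_wpM2l ?sqr_ge0 // exprn_ile1 //; exact: ltW.
Qed.

(** Two limits are taken. The partial sums of the dilate [f (rho z)] have coefficients controlled by
    a circle mean of [f], hence by its Hardy norm, and converge to the dilate; the dilates then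
    converge to [f] by continuity. *)
Lemma hardy_annulus_bound n (K : R) : 0 <= K ->
  (forall b N, (\int[mu]_(p in annulus r n) (modulus (pol b N (cplx p)) ^+ 2)%:E <=
     (K * \sum_(m < N) modulus (b m) ^+ 2)%:E)%E) ->
  forall f, analytic_disk f ->
  (\int[mu]_(p in annulus r n) (modulus (f (cplx p)) ^+ 2)%:E <= K%:E * hardy_sqnorm f)%E.
Proof.
move=> K0 HK f af; have mA := measurable_annulus r n.
have An1 p : annulus r n p -> modulus (cplx p) < 1.
  by move=> /andP[_ /lt_trans]; apply.
have sqcvg (u : nat -> R) (l : R) : u @ \oo --> l -> (fun j => u j ^+ 2) @ \oo --> l ^+ 2.
  by move=> ul; rewrite expr2; under eq_fun do rewrite expr2; apply: cvgM.
pose rho (j : nat) : R := 1 - 2 ^- j.+1.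
have rho01 j : 0 < rho j < 1.
  rewrite /rho half_powS; have := @half_pow_gt0 R j.
  have : 2 ^- j <= 1 :> R by rewrite invf_le1 ?exprn_gt0 // exprn_ege1 // ler1n.
  by move=> *; apply/andP; split; lra.
have step j : measurable_fun (annulus r n) (fun p => modulus (f ((rho j)%:C%C * cplx p)) ^+ 2) /\
    (\int[mu]_(p in annulus r n) (modulus (f ((rho j)%:C%C * cplx p)) ^+ 2)%:E <=
     K%:E * hardy_sqnorm f)%E.
  have [b [Hb Hc]] := power_expansion f (rho j) af (rho01 j).
  split.
    apply: (measurable_fun_cvg (h := fun N (p : plane R) => modulus (pol b N (cplx p)) ^+ 2)).
      by move=> N; exact: measurable_sqmodulus_pol.
    by move=> p /An1 /Hc; exact: sqcvg.
  apply: (fatou_bound mu (annulus r n) (fun N p => modulus (pol b N (cplx p)) ^+ 2)) => //.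
  - by move=> N; exact: measurable_sqmodulus_pol.
  - by move=> N p _; exact: sqr_ge0.
  - by move=> p /An1 /Hc; exact: sqcvg.
  - move=> N; apply: (le_trans (HK b N)); rewrite EFinM; apply: lee_wpmul2l => //.
    apply: (le_trans (Hb N)); apply: ereal_sup_ubound; exists (rho j) => //=.
    by case/andP: (rho01 j) => /ltW -> ->.
apply: (fatou_bound mu (annulus r n) (fun j p => modulus (f ((rho j)%:C%C * cplx p)) ^+ 2)) => //.
- by move=> j; case: (step j).
- by move=> j p _; exact: sqr_ge0.
- move=> p /An1 p1; apply: sqcvg; apply/cvgrPdist_lt => e e0.
  have [L [del [L0 del0 HL]]] := cdiff_lipschitz _ _ (derivable_cdiff f _ (af _ p1)).
  have m0 : 0 < Num.min del (e / L) by rewrite lt_min del0 divr_gt0.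
  have [J HJ] := half_pow_lt _ m0.
  exists J => // j /= Jj.
  have d1 : modulus ((rho j)%:C%C * cplx p - cplx p) < Num.min del (e / L).
    rewrite (_ : _ - _ = (- 2 ^- j.+1)%:C%C * cplx p); last first.
      by rewrite /rho rmorphB rmorph1 rmorphN; ring.
    rewrite modulusM modulus_real normrN ger0_norm ?(ltW (half_pow_gt0 _)) //.
    apply: le_lt_trans HJ; rewrite -[leRHS]mulr1; apply: ler_pM.
    - exact: ltW (half_pow_gt0 _).
    - exact: modulus_ge0.
    - by rewrite lef_pV2 ?posrE ?exprn_gt0 // ler_eXn2l ?ltr1n // ltnW.
    - exact: ltW.
  move: d1; rewrite lt_min => /andP[d1 d2]; rewrite distrC.
  apply: (le_lt_trans (modulus_dist _ _)); apply: (le_lt_trans (HL _ d1)).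
  by rewrite mulrC -ltr_pdivlMr.
- by move=> j; case: (step j).
Qed.

End CarlesonBounds.

Theorem theorem1 (R : realType) (w : R -> R) (r : nat -> R)
    (mu : {measure set (plane R) -> \bar R}) :
  admissible_weight w -> weight_radii w r ->
  (carleson (bergman w) (bergman_sqnorm r) mu <->
   exists C' : R, 0 < C' /\
     forall n : nat,
       carleson (@hardy R) (@hardy_sqnorm R) (annulus_part mu r n) /\
       carleson_constant (@hardy R) (@hardy_sqnorm R) (annulus_part mu r n)
         <= C' * 2 ^- n).
Proof.
move=> aw wr.
have r_ge0 := radius_ge0 w r wr; have r_lt1 := radius_lt1 w r wr.
have r_le := radius_le w aw r wr; have r_lt := radius_lt w aw r wr.
have r0 := radius0 w aw r wr.
have r1 : 0 < r 1%N by rewrite -r0; exact: r_lt.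
have [k k0 contract] := radius_contract w aw r wr.
have t0 f i : (0 <= ((2 ^- i)%R : R)%:E * circle_mean f (r i))%E.
  by apply: mule_ge0; [rewrite lee_fin ltW // half_pow_gt0|exact: circle_mean_ge0].
have annD n : annulus r n `<=` @cplx R @^-1` @unit_disk R.
  by move=> p /andP[_ /lt_trans]; apply.
split=> [[C [C0 HC]]|[C' [C'0 HC']]].
  have [B B0 HB] := weighted_power_sum r k r_ge0 r_lt1 r_le r1 k0 contract.
  (* [4] comes from [|z|^(2 K) >= 1 / 4] on the annulus, where [K] is the exponent supplied by [HB],
     and [B] from the Bergman norm of the shifted polynomial. *)
  exists (4 * C * B); split; first by rewrite !mulr_gt0.
  move=> n; have K0 : 0 < 4 * C * B * 2 ^- n by rewrite !mulr_gt0 // half_pow_gt0.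
  suff Hb : carleson_bound (@hardy R) (@hardy_sqnorm R) (annulus_part mu r n) (4 * C * B * 2 ^- n).
    by split; [exists (4 * C * B * 2 ^- n)|exact: carleson_constant_le].
  split=> // f [af _].
  rewrite disk_integral_annulus_part ?(ltW (r_lt1 _)) //.
  apply: hardy_annulus_bound => // {f af}; first exact: ltW.
  move=> b N; have [K [K2 HK]] := HB n.
  set S := \sum_(m < N) _; have S0 : 0 <= S by apply: sumr_ge0 => m _; exact: sqr_ge0.
  have mA := measurable_annulus r n; have mD := @measurable_disk R.
  set q := pol (shift_coef K b) (K + N).
  have qA p : annulus r n p -> modulus (pol b N (cplx p)) ^+ 2 <= 4 * modulus (q (cplx p)) ^+ 2.
    move=> /andP[rp _]; rewrite /q pol_shift modulusM modulusX exprMn mulrA.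
    rewrite -[leLHS]mul1r; apply: ler_wpM2r; first exact: sqr_ge0.
    have h : 1 / 2 <= modulus (cplx p) ^+ K.
      by apply: (le_trans K2); apply: lerXn2r; rewrite ?nnegrE ?modulus_ge0.
    have : (1 / 2) ^+ 2 <= (modulus (cplx p) ^+ K) ^+ 2.
      by apply: lerXn2r; rewrite ?nnegrE ?exprn_ge0 ?modulus_ge0.
    by rewrite expr2; lra.
  apply: (@le_trans _ _ (\int[mu]_(p in annulus r n) (4%:E * (modulus (q (cplx p)) ^+ 2)%:E))%E).
    apply: ge0_le_integral => //.
    - by move=> p _; rewrite lee_fin sqr_ge0.
    - exact: measurable_sqmodulus_pol_EFin.
    - by apply: emeasurable_funM => //; exact: measurable_sqmodulus_pol_EFin.
  have q0 (A : set (plane R)) p : A p -> (0 <= (modulus (q (cplx p)) ^+ 2)%:E)%E.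
    by move=> _; rewrite lee_fin sqr_ge0.
  rewrite (@ge0_integralZl_EFin _ _ _ mu _ mA _ (q0 (annulus r n))
    (measurable_sqmodulus_pol_EFin _ _ _) 4 (ler0n R 4)).
  have -> : 4 * C * B * 2 ^- n * S = 4 * (C * (B * 2 ^- n * S)) by ring.
  rewrite EFinM; apply: lee_wpmul2l => //.
  apply: (@le_trans _ _ (disk_integral mu (fun z => (modulus (q z) ^+ 2)%:E))).
    apply: (@ge0_subset_integral _ _ _ mu _ _ mA mD).
    - exact: measurable_sqmodulus_pol_EFin.
    - exact: q0.
    - exact: annD.
  apply: (le_trans (HC q (bergman_pol w _ _ aw))); rewrite EFinM; apply: lee_wpmul2l.
    by rewrite lee_fin ltW.
  apply: lime_le; first by apply: is_cvg_nneseries => i _ _; exact: t0.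
  apply: nearW => M.
  apply: (@le_trans _ _ (\sum_(1 <= i < M) (2 ^- i * r i ^+ (2 * K) * S)%:E)%E).
    apply: lee_sum => i _; rewrite -mulrA EFinM; apply: lee_wpmul2l.
      by rewrite lee_fin ltW // half_pow_gt0.
    exact: circle_mean_shift.
  by rewrite sumEFin lee_fin -mulr_suml ler_wpM2r.
(* One factor 2 comes from the Schur argument and one from exceeding the infimum; [2 ^+ k.+1]
   rewrites [2^-n] as the weight of the circle of index [n + k.+1]. *)
exists (4 * C' * 2 ^+ k.+1); split; first by rewrite !mulr_gt0 // exprn_gt0.
move=> f [af _].
have bound n : (\int[mu]_(p in annulus r n) (modulus (f (cplx p)) ^+ 2)%:E <=
    (4 * C' * 2 ^+ k.+1)%:E * (((2 ^- (n + k.+1))%R : R)%:E * circle_mean f (r (n + k.+1)%N)))%E.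
  have [cn Cn] := HC' n.
  have h0 := @half_pow_gt0 R n.
  have lt : C' * 2 ^- n < 2 * C' * 2 ^- n.
    by have := mulr_gt0 C'0 h0; lra.
  have hb := carleson_constant_bound _ _ _ _ (fun f _ => hardy_sqnorm_ge0 f) cn (le_lt_trans Cn lt).
  have rr : 0 < r (n + k.+1)%N < 1.
    by rewrite r_lt1 andbT (lt_le_trans r1) // r_le // addnS.
  (* The contraction starts from [r n.+1], the outer radius of the annulus. *)
  have hr : 1 - r (n + k.+1)%N <= (1 - r n.+1) / 2 by rewrite addnS -addSn.
  apply: (le_trans (analytic_annulus_bound mu r r_lt1 n _ _ f af hb rr hr)).
  rewrite muleA -EFinM; apply: lee_wpmul2r; first exact: circle_mean_ge0.
  rewrite lee_fin exprD invfM le_eqVlt; apply/orP; left; apply/eqP.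
  have h1 : 2 ^+ n != 0 :> R by rewrite expf_neq0 // pnatr_eq0.
  have h2 : 2 ^+ k.+1 != 0 :> R by rewrite expf_neq0 // pnatr_eq0.
  by field; rewrite h1 h2.
(* Iterated contraction gives [1 - r (j * k) <= 2^-j], so some radius exceeds [|z|]. The least such
   index is positive because [r 0 = 0], and its predecessor is the index of the annulus. *)
have DE : @cplx R @^-1` @unit_disk R = \bigcup_n annulus r n.
  apply/seteqP; split=> [p pD|p [n _]]; last exact: annD.
  have small j : 1 - r (j * k)%N <= 2 ^- j.
    elim: j => [|j IH]; first by rewrite mul0n r0 expr0 invr1 subr0.
    by rewrite mulSn addnC half_powS; have := contract (j * k)%N; lra.
  have ex : exists m, modulus (cplx p) < r m.
    have [j hj] := half_pow_lt (1 - modulus (cplx p)) ltac:(by rewrite subr_gt0).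
    by exists (j * k)%N; have := small j; lra.
  case: (ex_minnP ex) => -[|n]; first by rewrite r0 ltNge modulus_ge0.
  move=> lt_n min_n; exists n => //; apply/andP; split => //.
  by rewrite leNgt; apply/negP => /min_n; rewrite ltnn.
have triv : trivIset setT (annulus r).
  move=> i j _ _ [p [/andP[i1 i2] /andP[j1 j2]]].
  apply/eqP; rewrite eqn_leq; apply/andP; split; rewrite leqNgt; apply/negP => /r_le.
    by move=> /(lt_le_trans j2) /lt_le_trans /(_ i1); rewrite ltxx.
  by move=> /(lt_le_trans i2) /lt_le_trans /(_ j1); rewrite ltxx.
rewrite /disk_integral DE ge0_integral_bigcup //; first last.
- by move=> p _; rewrite lee_fin sqr_ge0.
- by rewrite -DE; apply/measurable_EFinP; exact: measurable_analytic.
- by move=> n; exact: measurable_annulus.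
have K0 : (0 <= (4 * C' * 2 ^+ k.+1)%:E)%E by rewrite lee_fin !mulr_ge0 ?exprn_ge0 // ltW.
apply: (@le_trans _ _ (\sum_(n <oo) ((4 * C' * 2 ^+ k.+1)%:E *
    (((2 ^- (n + k.+1))%R : R)%:E * circle_mean f (r (n + k.+1)%N))))%E).
  apply: lee_nneseries => [n _ _|n _]; last exact: bound.
  by apply: integral_ge0 => p _; rewrite lee_fin sqr_ge0.
rewrite nneseriesZl; last by move=> n _; exact: t0.
apply: lee_wpmul2l => //.
(* After the shift the sum runs over indices at least [k.+1]: a tail of the Bergman series, which
   starts at 1 and has nonnegative terms. *)
rewrite (nneseries_addn (f := fun i => ((2 ^- i)%R : R)%:E * circle_mean f (r i))%E) //.
rewrite /bergman_sqnorm (nneseries_split 1 k) //.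
by rewrite add1n; apply: leeDr; apply: sume_ge0 => i _; exact: t0.
Qed.
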